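(* Let $m$ be a positive integer with $m\equiv 3\bmod 4$. Let $V=D^{(m+1,m)}$ be the spin module for the symmetric group $\Sigma_{2m+1}$ over $\mathbb{F}_2$, a vector space of dimension $2^m$ over $\mathbb{F}_2$, equipped with a non-degenerate $\Sigma_{2m+1}$-invariant quadratic form $Q$. Let $\Sigma_{2m}$ be the stabilizer of a point in the natural action of $\Sigma_{2m+1}$ on $\{1,\dots,2m+1\}$, and let $U$ denote the socle of $V\downarrow_{\Sigma_{2m}}$. Let $V\downarrow_{\mathcal{A}_{2m+1}}=U_1\oplus U_2$, where $U_1$ and $U_2$ are non-isomorphic irreducible $\mathbb{F}_2\mathcal{A}_{2m+1}$-modules. Then $U_1$ and $U_2$ are both totally singular with respect to $Q$. Furthermore, let $g_1=1,g_2,\dots,g_{2m+1}$ be a set of left coset representatives for $\Sigma_{2m}$ in $\Sigma_{2m+1}$. Then $U=g_1U, g_2U,\dots,g_{2m+1}U, U_1$ and $U_2$ form a partial orthogonal spread in $V$ consisting of $2m+3$ subspaces.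
   Context: Quadratic forms. A quadratic form on a vector space $V$ over a finite field $K$ of characteristic 2 is a function $Q:V\to K$ with $Q(\lambda u)=\lambda^2Q(u)$ and $Q(u+v)=Q(u)+Q(v)+f(u,v)$ for all $\lambda\in K$, $u,v\in V$, where $f$ is an alternating bilinear form (the polarization of $Q$). $Q$ is non-degenerate if $f$ is non-degenerate. $Q$ is invariant under a group $G$ acting linearly on $V$ if $Q(gv)=Q(v)$ for all $g\in G$, $v\in V$. A subspace is totally singular if $Q$ vanishes on all its elements. If $\dim V=2r$ and $Q$ is non-degenerate of index $r$ (i.e. there is an $r$-dimensional totally singular subspace), a partial orthogonal spread is a set of $r$-dimensional totally singular subspaces that pairwise intersect trivially. Modules for symmetric groups. For a partition $\lambda$ of $n$ with no two equal parts (a 2-regular partition), $D^\lambda$ denotes the corresponding irreducible $\mathbb{F}_2\Sigma_n$-module, in the standard labelling: $D^\lambda=S^\lambda/(S^\lambda\cap (S^\lambda)^\perp)$, where $S^\lambda$ is the Specht module over $\mathbb{F}_2$, a submodule of the permutation module on $\lambda$-tabloids, and $\perp$ is taken with respect to the bilinear form on that permutation module for which the tabloids are orthonormal. The spin module of $\Sigma_{2m+1}$ over $\mathbb{F}_2$ is $D^{(m+1,m)}$ (of dimension $2^m$). The socle of a module is the sum of its irreducible submodules. $\mathcal{A}_{2m+1}$ is the alternating group in $\Sigma_{2m+1}$. For $m\equiv 3\bmod 4$ it is known that a non-degenerate $\Sigma_{2m+1}$-invariant quadratic form on $V$ exists and that $V\downarrow_{\mathcal{A}_{2m+1}}$ is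 a direct sum of two non-isomorphic irreducible modules. *)

(* Defs.v *)
(* Permutations compose from left to right in MathComp,
   (s * t) x = t (s x), and matrix representations act on row vectors from the
   right.  The left action of s on a vector v is therefore v *m rG s, and a left
   coset s H (for composition of functions from right to left) is H :* s. *)
From mathcomp Require Import all_boot all_order all_algebra all_fingroup.
From mathcomp Require Import all_solvable all_field all_character.

Set Implicit Arguments.
Unset Strict Implicit.
Unset Printing Implicit Defensive.

Import GRing.Theory.
Local Open Scope ring_scope.

Section QuadraticForms.

Variables (K : fieldType) (d : nat).
Implicit Types (Q : 'rV[K]_d -> K) (u v : 'rV[K]_d).

Definition quadratic_form Q : Prop :=
  (forall a u, Q (a *: u) = a ^+ 2 * Q u) /\
  exists f : {biscalar 'rV[K]_d},
    (forall u, f u u = 0) /\ (forall u v, Q (u + v) = Q u + Q v + f u v).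

Definition polarization Q u v : K := Q (u + v) - Q u - Q v.

Definition nondegenerate_form Q : Prop :=
  forall u, (forall v, polarization Q u v = 0) -> u = 0.

Definition invariant_form (gT : finGroupType) (G : {group gT})
    (rG : mx_representation K G d) Q : Prop :=
  forall g, g \in G -> forall v, Q (v *m rG g) = Q v.

Definition totally_singular Q (W : 'M[K]_d) : Prop :=
  forall v, (v <= W)%MS -> Q v = 0.

End QuadraticForms.

(* Subspaces are row spaces of square matrices.  The members of a spread are
   meant to be canonical representatives <<W>>%MS, for which equality of
   matrices is equality of row spaces (genmxP). *)
Definition partial_orthogonal_spread (K : finFieldType) (d : nat)
    (Q : 'rV[K]_d -> K) (r : nat) (S : {set 'M[K]_d}) : Prop :=
  [/\ d = (2 * r)%N,
      nondegenerate_form Q,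
      (exists W : 'M[K]_d, \rank W = r /\ totally_singular Q W),
      (forall W, W \in S -> \rank W = r /\ totally_singular Q W)
    & (forall W W', W \in S -> W' \in S -> W != W' -> (W :&: W' = 0)%MS)].

Section Specht.

(* la is meant to be a partition of n, as a nonincreasing sequence of
   positive integers; the permuted symbols are the elements of 'I_n. *)
Variables (F : fieldType) (n : nat) (la : seq nat).

(* A tableau is given by the (row, column) position of each symbol.  When
   sumn la = n, such an injection is a bijection onto the Young diagram. *)
Definition tableau :=
  {T : {ffun 'I_n -> 'I_(size la) * 'I_n} |
    injectiveb T && [forall x, (T x).2 < nth 0%N la (T x).1]%N}.

(* A tabloid is given by the row of each symbol. *)
Definition tabloid :=
  {t : {ffun 'I_n -> 'I_(size la)} |
    [forall i, #|[set x | t x == i]| == nth 0%N la i]}.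

Lemma tabloid_act_proof (t : tabloid) (s : 'S_n) :
  [forall i, #|[set x | [ffun x => val t (s^-1%g x)] x == i]| == nth 0%N la i].
Proof.
apply/forallP=> i; rewrite -(eqP (forallP (valP t) i)).
apply/eqP; rewrite -[RHS](card_imset _ (@perm_inj _ s)); apply: eq_card => x.
rewrite inE ffunE; apply/idP/imsetP => [Hx | [y]].
  by exists (s^-1%g x); rewrite ?inE ?permKV.
by rewrite inE => Hy ->; rewrite permK.
Qed.

Definition tabloid_act (t : tabloid) (s : 'S_n) : tabloid :=
  Sub [ffun x => val t (s^-1%g x)] (tabloid_act_proof t s).

Lemma tabloid_act1 t : tabloid_act t 1%g = t.
Proof. by apply: val_inj; rewrite /=; apply/ffunP=> x; rewrite ffunE invg1 perm1. Qed.

Lemma tabloid_actM t s1 s2 :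
  tabloid_act t (s1 * s2)%g = tabloid_act (tabloid_act t s1) s2.
Proof. by apply: val_inj; rewrite /=; apply/ffunP=> x; rewrite !ffunE invMg permM. Qed.

Lemma tabloid_act_eq t t' s :
  (tabloid_act t s == t') = (t == tabloid_act t' s^-1%g).
Proof.
by apply/eqP/eqP => [<-|->]; rewrite -tabloid_actM ?mulgV ?mulVg tabloid_act1.
Qed.

Local Notation N := #|{: tabloid}|.

Definition tabloid_mx (s : 'S_n) : 'M[F]_N :=
  \matrix_(i, j) (tabloid_act (enum_val i) s == enum_val j)%:R.

Lemma mul_tabloid_mx m (A : 'M[F]_(m, N)) s i j :
  (A *m tabloid_mx s) i j
    = A i (enum_rank (tabloid_act (enum_val j) s^-1%g)).
Proof.
rewrite mxE (bigD1 (enum_rank (tabloid_act (enum_val j) s^-1%g))) //=.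
rewrite mxE tabloid_act_eq enum_rankK eqxx mulr1 big1 ?addr0 // => k.
rewrite mxE tabloid_act_eq => nk; case: eqP => [e|]; last by rewrite mulr0.
by rewrite -e enum_valK eqxx in nk.
Qed.

Lemma tabloid_mx_repr : mx_repr [set: 'S_n] tabloid_mx.
Proof.
split=> [|s1 s2 _ _]; apply/matrixP=> i j.
  by rewrite !mxE tabloid_act1 (inj_eq enum_val_inj).
rewrite mul_tabloid_mx !mxE enum_rankK tabloid_actM tabloid_act_eq.
by [].
Qed.

(* The permutation module on tabloids; the tabloid t is the standard basis
   vector with index enum_rank t. *)
Canonical tabloid_repr := MxRepresentation tabloid_mx_repr.

Lemma tr_tabloid_mx s : (tabloid_mx s)^T = tabloid_mx s^-1%g.
Proof. by apply/matrixP=> i j; rewrite !mxE tabloid_act_eq eq_sym. Qed.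

Definition column_stabilizer (T : tableau) : {set 'S_n} :=
  [set p : 'S_n | [forall x, (val T (p x)).2 == (val T x).2]].

(* e_T = \sum_(p in C_T) sgn(p) {T p}: the row of x in T p is that of p^-1 x
   in T. *)
Definition polytabloid (T : tableau) : 'rV[F]_N :=
  \row_j \sum_(p in column_stabilizer T)
    (-1) ^+ odd_perm p
      * ([ffun x => (val T (p^-1%g x)).1] == val (enum_val j : tabloid))%:R.

Definition Specht_mx : 'M[F]_N := (\sum_(T : tableau) <<polytabloid T>>)%MS.

(* Row vectors v with v *m Specht_mx^T = 0, that is, orthogonal to the Specht
   module for the form in which tabloids are orthonormal. *)
Definition Specht_perp_mx : 'M[F]_N := kermx Specht_mx^T.

Lemma tableau_act_proof (T : tableau) (s : 'S_n) :
  let T' := [ffun x => val T (s^-1%g x)] in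
  injectiveb T' && [forall x, (T' x).2 < nth 0%N la (T' x).1]%N.
Proof.
have /andP[/injectiveP injT /forallP ltT] := valP T.
apply/andP; split; last by apply/forallP=> x; rewrite ffunE.
by apply/injectiveP=> x y; rewrite !ffunE => /injT /perm_inj.
Qed.

Definition tableau_act (T : tableau) (s : 'S_n) : tableau :=
  Sub [ffun x => val T (s^-1%g x)] (tableau_act_proof T s).

Lemma polytabloid_act T s :
  polytabloid T *m tabloid_mx s = polytabloid (tableau_act T s).
Proof.
apply/rowP=> j; rewrite mul_tabloid_mx !mxE enum_rankK /=.
rewrite [RHS](reindex_inj (conjg_inj s)) /=; apply: eq_big => [p | p _].
  rewrite !inE; apply/forallP/forallP => H x; last first.
    by have := H (s x); rewrite !ffunE permJ !permK.
  by rewrite !ffunE -{1}(permKV s x) permJ permK.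
rewrite odd_permJ; congr (_ * _%:R); congr (nat_of_bool _).
apply/eqP/eqP => /ffunP E; apply/ffunP=> x.
  have:= E (s^-1%g x); rewrite !ffunE invgK permKV => <-.
  by rewrite -conjVg -{1}(permKV s x) permJ permK.
have:= E (s x); rewrite !ffunE invgK => <-.
by rewrite -conjVg permJ permK.
Qed.

Lemma Specht_module : mxmodule tabloid_repr Specht_mx.
Proof.
apply/mxmoduleP=> s _; rewrite /Specht_mx sumsmxMr_gen.
apply/sumsmx_subP=> T _; rewrite genmxE (eqmxMr _ (genmxE _)) /=.
rewrite polytabloid_act (sumsmx_sup (tableau_act T s)) //.
by rewrite genmxE.
Qed.

Lemma Specht_perp_module : mxmodule tabloid_repr Specht_perp_mx.
Proof.
apply/mxmoduleP=> s _; apply/sub_kermxP; rewrite /= -mulmxA.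
rewrite -[tabloid_mx s]trmxK -trmx_mul tr_tabloid_mx.
have /submxP[A ->] :=
  mxmoduleP Specht_module s^-1%g (in_setT _).
by rewrite trmx_mul mulmxA mulmx_ker mul0mx.
Qed.

Lemma Specht_rad_module :
  mxmodule tabloid_repr (Specht_mx :&: Specht_perp_mx)%MS.
Proof. exact: capmx_module Specht_module Specht_perp_module. Qed.

Definition Dmod_dim : nat :=
  \rank <<in_factmod (Specht_mx :&: Specht_perp_mx)%MS Specht_mx>>%MS.

(* D^la = S^la / (S^la :&: S^la^perp): section_repr of modules U and V is the
   action on the image of V in the quotient of the whole space by U. *)
Definition Dmod : mx_representation F [set: 'S_n] Dmod_dim :=
  section_repr Specht_rad_module Specht_module.

End Specht.

Definition spin_dim (m : nat) : nat :=
  Dmod_dim 'F_2 (2 * m).+1 [:: m.+1; m].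

Definition spin_module (m : nat) :
    mx_representation 'F_2 [set: 'S_(2 * m).+1] (spin_dim m) :=
  Dmod 'F_2 (2 * m).+1 [:: m.+1; m].

Definition point_stabilizer (n : nat) (x : 'I_n) : {group 'S_n} :=
  'C_[set: 'S_n][x | 'P]%G.

Definition spin_Alt (m : nat) :
    mx_representation 'F_2 'Alt_('I_(2 * m).+1)%G (spin_dim m) :=
  subg_repr (spin_module m) (subsetT _).

Definition spin_stab (m : nat) (x : 'I_(2 * m).+1) :
    mx_representation 'F_2 (point_stabilizer x) (spin_dim m) :=
  subg_repr (spin_module m) (subsetT _).

Definition module_socle (F : decFieldType) (gT : finGroupType) (G : {group gT})
    (d : nat) (rG : mx_representation F G d) : 'M[F]_d :=
  Socle (DecSocleType rG).

(* Main.v *)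
(* Write R i j for the action of the transposition (i j) on V, and c for a
   3-cycle.  The key fact is that 1 + c + c^2 kills V, that is,
     R i j * R j k + R j k * R i j = 1    and    R i k = R i j + R j k,
   so that V is a spinor module for the Clifford algebra spanned by products of
   transpositions.  On the polytabloid e of a tableau T, a tabloid being seen as
   the vector of F_2^(2m+1) of its row numbers, e is the indicator function of
   an affine subspace, with one equation for each column.  If no two symbols of c
   share a column, e (1 + c + c^2) restricted to tabloids is the indicator of the
   m - 2 equations of the columns that c does not meet; its product with another
   polytabloid is then the number modulo 2 of solutions of 2m - 1 affine equations
   in 2m + 1 variables, which is 0.
   For the m disjoint transpositions t_j within the columns of T, the product of
   the 1 + t_j is e^T e on the permutation module.  As in James's submodule
   theorem, it follows that V is irreducible with scalar centralizer.  By the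
   first relation each factor halves the rank, whence dim V = 2^m.
   Let s_x be the sum of the R x k for k != x.  Then s_x^2 = 1 (m is odd), s_x
   commutes with the stabilizer of x, and s_x + s_y = R x y.  Hence the socle for
   this stabilizer is the fixed space ker (1 + s_x), of dimension 2^(m-1), and two
   such spaces meet in 0.  Odd permutations exchange U_1 and U_2, hence so does
   s_x, and U_i meets ker (1 + s_x) in 0.
   For the polarization of Q, each R i j is self-adjoint, so ker (1 + s_x) =
   im (1 + s_x) is isotropic.  The sum w of the R x i * R x j for i < j satisfies
   w * R x k + R x k * w = R x k and w^* = w + 1; the projection onto U_1 along U_2
   has the same commutators with the R x k, so it differs from w by a scalar and
   satisfies p^* = p + 1 too, which makes U_1 and U_2 isotropic.  Finally
   Q vanishes on an isotropic subspace W stable under a 3-cycle c: as u = u c + u c^-1,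
   Q u = Q (u c) + Q (u c^-1) = 0. *)
Require Import Defs.
From mathcomp Require Import all_boot all_order all_algebra all_fingroup.
From mathcomp Require Import all_solvable all_field all_character.
From mathcomp Require Import zify.
Import GRing.Theory.
Local Open Scope ring_scope.

Set Implicit Arguments.
Unset Strict Implicit.
Unset Printing Implicit Defensive.

(** * Arithmetic in characteristic 2 *)

Lemma addrr_F2 (V : lmodType 'F_2) (v : V) : v + v = 0.
Proof. by rewrite -mulr2n -scaler_nat (_ : 2%:R = 0) ?scale0r //; apply/eqP. Qed.

Lemma F2_addrr (a : 'F_2) : a + a = 0.
Proof. by apply: addrr_pchar2; apply: pchar_Fp. Qed.

Lemma addKr_F2 (V : lmodType 'F_2) (u : V) : involutive (+%R u).
Proof. by move=> v; rewrite addrA addrr_F2 add0r. Qed.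

Lemma mulrnF2 (V : lmodType 'F_2) (v : V) k : v *+ k = if odd k then v else 0.
Proof.
by rewrite -{1}(odd_double_half k) mulrnDr -mul2n mulrnA mulr2n addrr_F2 mul0rn addr0; case: odd.
Qed.

Lemma sum_pairs (V : nmodType) n (A : pred 'I_n) (f : 'I_n -> 'I_n -> V) :
  \sum_(i | A i) \sum_(j | A j) f i j
    = \sum_(i | A i) f i i
      + \sum_(i | A i) \sum_(j | A j && (i < j)%N) (f i j + f j i).
Proof.
transitivity (\sum_(i | A i) (f i i + \sum_(j | A j && (i < j)%N) f i j
                + \sum_(j | A j && (j < i)%N) f i j)).
  apply: eq_bigr => i Ai; rewrite (bigD1 i) //= -addrA; congr (_ + _).
  rewrite (bigID (fun j : 'I_n => (i < j)%N)) /=; congr (_ + _); apply: eq_bigl => j.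
    by rewrite -andbA; congr (_ && _); rewrite -val_eqE /=; case: ltngtP.
  rewrite -andbA; congr (_ && _).
  by rewrite -val_eqE /=; case: ltngtP.
rewrite !big_split /= -addrA; congr (_ + _); rewrite [in RHS](eq_bigr (fun i : 'I_n =>
  \sum_(j | A j && (i < j)%N) f i j + \sum_(j | A j && (i < j)%N) f j i)); last first.
  by move=> i _; rewrite big_split.
rewrite big_split /=; congr (_ + _).
rewrite [RHS](exchange_big_dep A) /= => [|i j _ /andP[]//].
by apply: eq_bigr => j Aj; apply: eq_bigl => i; rewrite Aj.
Qed.

(** * Spin representations of symmetric groups *)

Definition pt m k : 'I_(2 * m).+1 := inord k.

(* The pairs {2j, 2j+1} are the columns of std_tableau; ord_max is the symbol left alone. *)
Fixpoint pair_product m d (rG : mx_representation 'F_2 [set: 'S_(2 * m).+1] d) k : 'M_d :=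
  if k is k'.+1 then
    pair_product rG k' *m (1%:M + rG (tperm (pt m (2 * k')) (pt m (2 * k').+1)))
  else 1%:M.

(** * Clifford relations between transpositions *)

Section SpinRelations.

Variables (m d : nat) (rG : mx_representation 'F_2 [set: 'S_(2 * m).+1] d).
Local Notation R i j := (rG (tperm i j)).

Hypothesis three : forall i j k, i != j -> j != k -> i != k ->
  R i j *m R j k + R j k *m R i j = 1%:M.

Lemma repr_permM s t : rG (s * t)%g = rG s *m rG t.
Proof. by rewrite repr_mxM ?inE. Qed.

Lemma repr_tperm_sq i j : R i j *m R i j = 1%:M.
Proof. by rewrite -repr_permM tperm2 repr_mx1. Qed.

Lemma tpermD_comm (T : finType) (i j k l : T) :
  i != k -> i != l -> j != k -> j != l -> commute (tperm i j) (tperm k l).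
Proof.
move=> ik il jk jl; apply/commgP/conjg_fixP.
by rewrite tpermJ !tpermD // eq_sym.
Qed.

Lemma repr_tpermC i j k l :
  i != k -> i != l -> j != k -> j != l -> R i j *m R k l = R k l *m R i j.
Proof. by move=> *; rewrite -!repr_permM tpermD_comm. Qed.

(** As (i k) = (i j)(j k)(i j), [three] moves the last factor past (j k), and (i j) squares to 1. *)
Lemma tperm_sum i j k : i != j -> j != k -> i != k -> R i k = R i j + R j k.
Proof.
move=> ij jk ik.
have -> : tperm i k = ((tperm i j) * (tperm j k * tperm i j))%g.
  have := tpermJ j k (tperm i j); rewrite tpermR tpermD // => <-.
  by rewrite conjgE tpermV.
rewrite !repr_permM.
have -> : R j k *m R i j = 1%:M + R i j *m R j k.
  by rewrite -(three ij jk ik) -addrA addrC -addrA addrr_F2 addr0.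
by rewrite mulmxDr mulmx1 mulmxA repr_tperm_sq mul1mx.
Qed.


(** For fixed x, the [R x k] behave as Clifford generators: the anticommutator of two distinct ones
    is 1, and that of one with itself is 2 = 0. *)
Lemma star_tperm_anticomm x i k : i != x -> k != x ->
  R x k *m R x i + R x i *m R x k = (k != i)%:R%:M.
Proof.
move=> ix kx; have [->|ki] := eqVneq k i; first by rewrite addrr_F2 raddf0.
by rewrite [tperm x k]tpermC three // eq_sym.
Qed.

(** The element s_x of the overview. *)
Definition star x := \sum_(k | k != x) R x k.

Lemma star_conj x g : star x *m rG g = rG g *m star (g x).
Proof.
rewrite /star mulmx_suml mulmx_sumr [RHS](reindex_inj (@perm_inj _ g)) /=.
apply: eq_big => [k|k _]; first by rewrite (inj_eq perm_inj).
by rewrite -tpermJ -!repr_permM conjgE mulKVg.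
Qed.

Lemma sum_others (V : nmodType) (v : V) (x : 'I_(2 * m).+1) :
  \sum_(i | i != x) v = v *+ (2 * m).
Proof.
transitivity (v *+ #|predC1 x|); last by rewrite cardC1 card_ord.
by rewrite -sumr_const; apply: eq_bigl => i; rewrite !inE.
Qed.

Lemma sum_others2 (V : lmodType 'F_2) (v : V) (x y : 'I_(2 * m).+1) : x != y ->
  \sum_(i | (i != x) && (i != y)) v = v.
Proof.
move=> xy; have := sum_others v x.
rewrite (bigD1 y) 1?eq_sym //= mulrnF2 oddM /= => /(canRL (addKr_F2 v)).
by rewrite addr0.
Qed.

Definition npairs (x : 'I_(2 * m).+1) :=
  (\sum_(i | i != x) \sum_(j | (j != x) && (i < j)) 1)%N.

(** There are m(2m - 1) pairs. The parity is read off by counting ordered pairs: (2m)^2 = 2m + 2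
    [npairs x]. *)
Lemma odd_npairs x : odd (npairs x) = odd m.
Proof.
have := @sum_pairs nat _ (fun i => i != x) (fun _ _ => 1%N).
rewrite !sum_others.
have -> : \sum_(i | i != x) \sum_(j | (j != x) && (i < j)%N) (1 + 1 : nat) = (2 * npairs x)%N.
  by rewrite /npairs big_distrr; apply: eq_bigr => i _; rewrite big_distrr.
have mulrn_nat (k l : nat) : k *+ l = (k * l)%N.
  by elim: l => [|l IHl]; rewrite ?muln0 // mulrS IHl mulnS.
rewrite !mulrn_nat !mul1n => e.
have {}e : (2 * m * (2 * m) = 2 * m + 2 * npairs x)%N by exact: e.
have : odd (m * (2 * m)) = odd (m + npairs x).
  by congr odd; apply/eqP; rewrite -(eqn_pmul2l (isT : 0 < 2)%N) mulnA e mulnDr.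
by rewrite !oddM oddD /= andbF; case: odd; case: odd.
Qed.

Hypothesis odd_m : odd m.

(* [quad x] is the element w above, [quadT x] its adjoint. *)
Definition quad (x : 'I_(2 * m).+1) :=
  \sum_(i | i != x) \sum_(j | (j != x) && (i < j)%N) R x i *m R x j.
Definition quadT (x : 'I_(2 * m).+1) :=
  \sum_(i | i != x) \sum_(j | (j != x) && (i < j)%N) R x j *m R x i.

(** Each pair contributes an anticommutator equal to 1, and the number of pairs is odd. *)
Lemma quad_rev x : quad x + quadT x = 1%:M.
Proof.
have -> : quad x + quadT x = 1%:M *+ npairs x.
  rewrite /npairs -sumrMnr /quad /quadT -big_split; apply: eq_bigr => i ix.
  rewrite -sumrMnr -big_split; apply: eq_bigr => j /andP[jx ij] /=.
  by rewrite star_tperm_anticomm // -val_eqE (ltn_eqF ij) mulr1n.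
by rewrite mulrnF2 odd_npairs odd_m.
Qed.

(** The 2m squares on the diagonal cancel; the off-diagonal terms add up to [quad x + quadT x]. *)
Lemma star_sq x : star x *m star x = 1%:M.
Proof.
rewrite /star mulmx_suml; under eq_bigr do rewrite mulmx_sumr.
rewrite sum_pairs (eq_bigr (fun=> 1%:M)) => [|i _]; last by rewrite repr_tperm_sq.
rewrite sum_others mulrnF2 oddM add0r -[RHS](quad_rev x) -big_split.
by apply: eq_bigr => i _; rewrite -big_split.
Qed.

(** Expanding each [R y k] as [R x y + R x k] yields 2m - 1 copies of [R x y], which cancel the term
    [R y x] of [star y]. *)
Lemma star_swap x y : x != y -> star y = star x + R x y.
Proof.
move=> xy; rewrite /star (bigD1 x) //= [in RHS](bigD1 y) 1?eq_sym //=.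
rewrite [RHS]addrAC addrr_F2 add0r [tperm y x]tpermC.
transitivity (R x y + \sum_(k | (k != y) && (k != x)) (R x y + R x k)).
  congr (_ + _); apply: eq_bigr => k /andP[ky kx].
  by rewrite (@tperm_sum y x k) 1?[tperm y x]tpermC // eq_sym.
rewrite big_split /= sum_others2 1?eq_sym //.
by rewrite addrA addrr_F2 add0r; apply: eq_bigl => k; rewrite andbC.
Qed.

Lemma star_anticomm x k : k != x -> R x k *m star x + star x *m R x k = 1%:M.
Proof.
move=> kx; rewrite mulmx_sumr mulmx_suml -big_split /=.
rewrite (bigD1 k) //= addrr_F2 add0r (eq_bigr (fun=> 1%:M)) => [|i /andP[ix ik]].
  by rewrite sum_others2 // eq_sym.
by rewrite star_tperm_anticomm // eq_sym ik.
Qed.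

(** Moving [R x k] past [R x i *m R x j] leaves [f i j + f j i]. Over all pairs this is the full
    double sum of f, equal to [star x], minus its diagonal, equal to [star x - R x k]. *)
Lemma quad_anticomm x k : k != x -> R x k *m quad x + quad x *m R x k = R x k.
Proof.
move=> kx; pose f (i j : 'I_(2 * m).+1) : 'M['F_2]_d := (k != i)%:R *: R x j.
have mulmx_quad i j : i != x -> j != x ->
  R x k *m (R x i *m R x j) + R x i *m R x j *m R x k = f i j + f j i.
  move=> ix jx; have /(canRL (addKr_F2 _)) e := star_tperm_anticomm kx ix.
  rewrite mulmxA e mulmxDl addrAC -2!mulmxA -mulmxDr star_tperm_anticomm //.
  by rewrite mul_mx_scalar mul_scalar_mx addrC (eq_sym i k).
have -> : R x k *m quad x + quad x *m R x k =
    \sum_(i | i != x) \sum_(j | (j != x) && (i < j)%N) (f i j + f j i).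
  rewrite /quad mulmx_suml mulmx_sumr -big_split; apply: eq_bigr => i ix /=.
  rewrite mulmx_suml mulmx_sumr -big_split; apply: eq_bigr => j /andP[jx _] /=.
  exact: mulmx_quad.
have := sum_pairs (fun i => i != x) f; move/(canLR (addKr _)) => <-.
have -> : \sum_(i | i != x) \sum_(j | j != x) f i j = star x.
  under eq_bigr do rewrite -scaler_sumr.
  rewrite (bigD1 k) //= eqxx scale0r add0r -[RHS](@sum_others2 _ _ x k) 1?eq_sym //.
  by apply: eq_bigr => i /andP[_ ik]; rewrite eq_sym ik scale1r.
rewrite (bigD1 k) //= /f eqxx scale0r add0r addrC /star [X in X - _](bigD1 k) //=.
rewrite -[RHS]addr0 -addrA; congr (_ + _); apply/eqP; rewrite subr_eq0; apply/eqP.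
by apply: eq_bigr => i /andP[_ ik]; rewrite eq_sym ik scale1r.
Qed.

(** On W the kernel of A equals its image: if v A = 0, then v = v (A B + B A) = (v B) A.
    Rank-nullity concludes. *)
Lemma rank_halving (A B W : 'M['F_2]_d) :
  A *m A = 0 -> A *m B + B *m A = 1%:M ->
  (W *m A <= W)%MS -> (W *m B <= W)%MS -> \rank W = (2 * \rank (W *m A))%N.
Proof.
move=> AA AB WA WB; rewrite -(mxrank_mul_ker W A) mul2n -addnn; congr (_ + _)%N.
apply: eqmx_rank; apply/andP; split; last first.
  by rewrite sub_capmx WA; apply/sub_kermxP; rewrite -mulmxA AA mulmx0.
apply/rV_subP => v; rewrite sub_capmx => /andP[vW /sub_kermxP vA].
rewrite -[v]mulmx1 -AB mulmxDr !mulmxA vA mul0mx add0r submxMr //.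
by apply: submx_trans WB; apply: submxMr.
Qed.

Lemma add1_sq (A : 'M['F_2]_d) : A *m A = 1%:M -> (1%:M + A) *m (1%:M + A) = 0.
Proof.
by move=> AA; rewrite mulmxDl !mulmxDr AA !mul1mx !mulmx1 [A + _]addrC addrr_F2.
Qed.

Lemma add1_anticomm (A B : 'M['F_2]_d) : (1%:M + A) *m B + B *m (1%:M + A) = A *m B + B *m A.
Proof.
by rewrite mulmxDl mulmxDr mul1mx mulmx1 addrACA addrr_F2 add0r.
Qed.

Lemma val_pt k : (k < (2 * m).+1)%N -> pt m k = k :> nat.
Proof. exact: inordK. Qed.

Lemma pt_inj j k : (j < (2 * m).+1)%N -> (k < (2 * m).+1)%N -> (pt m j == pt m k) = (j == k).
Proof. by move=> lj lk; rewrite -val_eqE /= !val_pt. Qed.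

Lemma pt_neq a (c : 'I_(2 * m).+1) : (a < c)%N -> pt m a != c.
Proof.
move=> ac; rewrite -val_eqE /= val_pt ?ltn_eqF //.
exact: ltn_trans ac (ltn_ord c).
Qed.

Lemma pair_product_comm k (i j : 'I_(2 * m).+1) :
  (2 * k <= i)%N -> (2 * k <= j)%N ->
  pair_product rG k *m R i j = R i j *m pair_product rG k.
Proof.
elim: k => [|k IHk] ki kj /=; first by rewrite mulmx1 mul1mx.
rewrite mul2n doubleS -mul2n in ki kj.
have [ai aj] : pt m (2 * k) != i /\ pt m (2 * k) != j.
  by split; apply: pt_neq; apply: leq_trans (leqnSn _) _.
have [bi bj] : pt m (2 * k).+1 != i /\ pt m (2 * k).+1 != j by split; apply: pt_neq.
rewrite -mulmxA mulmxDl mul1mx (repr_tpermC ai aj bi bj).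
rewrite -{1}[R i j]mulmx1 -mulmxDr !mulmxA IHk //; first exact: ltnW (ltnW ki).
exact: ltnW (ltnW kj).
Qed.

Lemma rank_pair_product k : (k <= m)%N -> d = (2 ^ k * \rank (pair_product rG k))%N.
Proof.
elim: k => [|k IHk] km /=; first by rewrite mxrank1 mul1n.
rewrite {1}(IHk (ltnW km)) expnSr -mulnA; congr (_ * _)%N.
have k2 : ((2 * k).+1 < 2 * m)%N by rewrite !mul2n -doubleS leq_double.
have v0 : pt m (2 * k) = (2 * k)%N :> nat by rewrite val_pt // ltnS (ltnW (ltnW k2)).
have v1 : pt m (2 * k).+1 = (2 * k).+1 :> nat by rewrite val_pt // ltnS (ltnW k2).
have ab : pt m (2 * k) != pt m (2 * k).+1 by rewrite pt_neq ?v1.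
have az : pt m (2 * k) != ord_max by rewrite pt_neq //= ltnW.
have bz : pt m (2 * k).+1 != ord_max by rewrite pt_neq.
(* The auxiliary operator moves a symbol of the new pair to [ord_max]. It avoids the earlier pairs,
   so it commutes with their factors and preserves the image. *)
apply: (@rank_halving _ (R (pt m (2 * k)) ord_max)).
- exact: add1_sq (repr_tperm_sq _ _).
- by rewrite add1_anticomm [tperm (pt m (2 * k)) _]tpermC three // eq_sym.
- rewrite mulmxDr mulmx1 pair_product_comm ?v0 ?v1 //.
  by rewrite addmx_sub ?submxMl.
- by rewrite pair_product_comm ?v0 ?submxMl //= leq_mul2l ltnW.
Qed.

(** * Dimension and the fixed spaces of the s_x *)

Hypothesis rank_pairs : (\rank (pair_product rG m) <= 1)%N.

Lemma dim_spin : (0 < d)%N -> d = (2 ^ m)%N.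
Proof.
have := rank_pair_product (leqnn m); move: rank_pairs.
by case: (\rank _) => [|[]] // _; rewrite ?muln0 ?muln1 => ->.
Qed.

Hypothesis irrG : mx_irreducible rG.

Hypothesis centG : forall A : 'M_d,
  (forall g, A *m rG g = rG g *m A) -> exists c, A = c%:M.

Lemma spin_gt0 : (0 < d)%N.
Proof. by case/mx_irrP: irrG. Qed.

Lemma spin_full (W : 'M_d) : mxmodule rG W -> W != 0 -> (1%:M <= W)%MS.
Proof. by case/mx_irrP: irrG => _ irr modW nzW; rewrite sub1mx irr. Qed.

(** The transpositions moving x generate the symmetric group. *)
Lemma star_tperm_module x m1 (W : 'M_(m1, d)) :
  (forall k, k != x -> W *m R x k <= W)%MS -> mxmodule rG W.
Proof.
move=> Wx; suff : (<<[set tperm x k | k in 'I_(2 * m).+1]>> \subset rstabs rG W)%g.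
  by rewrite gen_tperm.
rewrite gen_subG; apply/subsetP => _ /imsetP[k _ ->]; rewrite inE in_setT /=.
have [->|] := eqVneq k x; last exact: Wx.
by rewrite tperm1 repr_mx1 mulmx1.
Qed.

Definition star_space x := kermx (1%:M + star x).

Lemma star_spaceE x (v : 'rV_d) : (v <= star_space x)%MS = (v *m star x == v).
Proof.
rewrite (sameP sub_kermxP eqP) mulmxDr mulmx1.
apply/eqP/eqP => [/(canRL (addKr_F2 _))|->]; rewrite ?addr0 //; exact: addrr_F2.
Qed.


(** A vector fixed by s_x and s_y is killed by their sum [R x y], which is invertible. *)
Lemma star_space_cap x y : x != y -> (star_space x :&: star_space y = 0)%MS.
Proof.
move=> xy; apply/eqP/rowV0P => v; rewrite sub_capmx !star_spaceE.
move=> /andP[/eqP vx /eqP]; rewrite (star_swap xy) mulmxDr vx => /(canRL (addKr_F2 v)).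
rewrite addrr_F2 => v0.
by rewrite -[v](repr_mxK rG (in_setT (tperm x y))) v0 mul0mx.
Qed.

Lemma star_spaceJ x g : (star_space x *m rG g :=: star_space (g x))%MS.
Proof.
have sub y h : (star_space y *m rG h <= star_space (h y))%MS.
  apply/rV_subP => _ /submxP[u ->]; rewrite mulmxA.
  have := submxMl u (star_space y); rewrite !star_spaceE; move: (u *m _) => w /eqP e.
  by rewrite -mulmxA -star_conj mulmxA e.
apply/eqmxP; rewrite sub /= -{1}[star_space _](repr_mxKV rG (in_setT g)).
by rewrite submxMr // -{2}[x](permK g) sub.
Qed.

Hypothesis m_gt0 : (0 < m)%N.

Lemma other_point (x : 'I_(2 * m).+1) : exists k, k != x.
Proof.
have [e|] := eqVneq x ord0; last by exists ord0; rewrite eq_sym.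
exists ord_max; rewrite e -val_eqE /= -lt0n muln_gt0.
by rewrite m_gt0.
Qed.

(** [1 + star x] squares to 0 and has anticommutator 1 with [R x k], so [rank_halving] applies to
    the whole space. *)
Lemma rank_star_space x : \rank (star_space x) = (2 ^ m.-1)%N.
Proof.
have [k kx] := other_point x.
have AA := add1_sq (star_sq x).
have AB : (1%:M + star x) *m R x k + R x k *m (1%:M + star x) = 1%:M.
  by rewrite add1_anticomm addrC star_anticomm.
have := rank_halving AA AB (submx1 _) (submx1 _).
rewrite mxrank1 mul1mx mxrank_ker => e.
apply/eqP; rewrite -(eqn_pmul2l (isT : 0 < 2)%N) -expnS prednK // -dim_spin ?spin_gt0 //.
by rewrite mulnBr -e mul2n -addnn addnK.
Qed.

(** The kernel of [1 + star x] lies in its image: the preimage of u is [u *m R x k], by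
    [star_anticomm]. *)
Lemma star_space_sub x (u : 'rV_d) :
  (u <= star_space x)%MS -> exists v, u = v *m (1%:M + star x).
Proof.
have [k kx] := other_point x; rewrite star_spaceE => /eqP us; exists (u *m R x k).
by rewrite mulmxDr mulmx1 -{1}[u]mulmx1 -(star_anticomm kx) mulmxDr !mulmxA us addrC.
Qed.

(** [W + W *m R x k] is stable under every [R x y], hence is the whole space by irreducibility. So W
    has dimension at least 2^(m-1), which is that of [star_space x]. *)
Lemma star_space_min x (W : 'M_d) : W != 0 -> (W <= star_space x)%MS ->
  (forall i j, i != x -> j != x -> W *m R i j <= W)%MS -> (star_space x <= W)%MS.
Proof.
move=> nzW WS modW; have [k kx] := other_point x; have xk : x != k by rewrite eq_sym.
have full : (1%:M <= W + W *m R x k)%MS.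
  have modT : mxmodule rG (W + W *m R x k)%MS.
    apply: (star_tperm_module (x := x)) => y yx; rewrite addsmxMr.
    have [->|yk] := eqVneq y k.
      by rewrite -mulmxA repr_tperm_sq mulmx1 addsmxC submx_refl.
    have ky : k != y by rewrite eq_sym.
    have sub1 : (W *m R x y <= W + W *m R x k)%MS.
      rewrite (@tperm_sum x k y) 1?eq_sym // mulmxDr addmx_sub ?addsmxSr //.
      by apply: submx_trans (addsmxSl _ _); apply: modW.
    rewrite addsmx_sub sub1 /=.
    (* Exchange [R x k] and [R x y], then expand [R x y] through k: this reduces to W, to its image
       under [R k y], and to [R x k] squared. *)
    rewrite -mulmxA; have /(canRL (addKr_F2 _)) -> := star_tperm_anticomm kx yx.
    rewrite mulmxDr mul_mx_scalar addmx_sub //; last first.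
      by rewrite scalemx_sub ?addsmxSl.
    rewrite mulmxA (@tperm_sum x k y) 1?eq_sym // mulmxDr mulmxDl addmx_sub //.
      by rewrite -mulmxA repr_tperm_sq mulmx1 addsmxSl.
    by apply: submx_trans (addsmxSr _ _); apply: submxMr; apply: modW.
  rewrite -(genmxE (W + _)%MS) spin_full ?(eqmx_module _ (genmxE _)) //.
  rewrite (eqmx_eq0 (genmxE _)); apply: contraNneq nzW => e.
  by rewrite -submx0 -e addsmxSl.
rewrite -mxrank_leqif_sup // rank_star_space.
have := mxrankS full; rewrite mxrank1.
move/leq_trans/(_ (mxrank_adds_leqif _ _).1).
rewrite {1}dim_spin ?spin_gt0 // -{1}(prednK m_gt0) expnS.
move/leq_trans/(_ (leq_add (leqnn _) (mxrankM_maxl _ _))).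
rewrite addnn -mul2n leq_pmul2l // => le1; rewrite eqn_leq.
by rewrite le1 -(rank_star_space x) mxrankS.
Qed.

Lemma point_stabilizerE (x : 'I_(2 * m).+1) g :
  (g \in point_stabilizer x) = (g x == x).
Proof.
rewrite /point_stabilizer /= in_setI in_setT.
by apply/astab1P/eqP.
Qed.

(** * The socle for a point stabilizer *)

Section Stabilizer.

Variables (x : 'I_(2 * m).+1) (sH : point_stabilizer x \subset [set: 'S_(2 * m).+1]).
Local Notation rH := (subg_repr rG sH).

Lemma stab_tperm i j : i != x -> j != x -> tperm i j \in point_stabilizer x.
Proof. by move=> ix jx; rewrite point_stabilizerE tpermD. Qed.

Lemma star_space_simple : mxsimple rH (star_space x).
Proof.
split=> [||W modW sWS nzW].
- apply/mxmoduleP => g; rewrite point_stabilizerE => /eqP gx.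
  by rewrite /= star_spaceJ gx.
- by rewrite -mxrank_eq0 rank_star_space -lt0n expn_gt0.
- apply: star_space_min => // i j ix jx.
  exact: (mxmoduleP modW _ (stab_tperm ix jx)).
Qed.

(** By [star_swap], s_x is the sum of the [R k i] with i distinct from k and x, and all these
    transpositions fix x. *)
Lemma stab_module_star (W : 'M_d) : mxmodule rH W -> (W *m star x <= W)%MS.
Proof.
move=> modW; have [k kx] := other_point x.
have xk : x != k by rewrite eq_sym.
rewrite (star_swap kx) /star (bigD1 x) //= addrAC addrr_F2 add0r mulmx_sumr.
by apply: summx_sub => i /andP[ik ix]; apply: (mxmoduleP modW); apply: stab_tperm.
Qed.

Lemma star_hom (W : 'M_d) : (W <= dom_hom_mx rH (1%:M + star x))%MS.
Proof.
apply/hom_mxP => g; rewrite point_stabilizerE => /eqP gx /=.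
by rewrite -!mulmxA; congr (_ *m _); rewrite mulmxDl mulmxDr mul1mx mulmx1 star_conj gx.
Qed.

(** [1 + star x] commutes with the stabilizer and preserves W. If nonzero on W, it would be
    injective there by Schur's lemma, yet it squares to 0. *)
Lemma simple_sub_star_space W : mxsimple rH W -> (W <= star_space x)%MS.
Proof.
move=> simW; have [modW _ _] := simW.
apply/sub_kermxP/eqP; apply/idPn => nz.
have := mx_Schur_inj simW (star_hom _) nz; apply/eqP.
apply: contra nz => /eqP cap0; rewrite -submx0 -cap0 sub_capmx.
apply/andP; split; last by apply/sub_kermxP; rewrite -mulmxA add1_sq ?star_sq ?mulmx0.
by rewrite mulmxDr mulmx1 addmx_sub ?stab_module_star.
Qed.

Lemma socle_star_space : (module_socle rH :=: star_space x)%MS.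
Proof.
apply/eqmxP; rewrite /module_socle (simple_Socle _ star_space_simple) andbT.
case: (Socle_semisimple (DecSocleType rH)) => I V /= simV <- _.
by apply/sumsmx_subP => i _; apply: simple_sub_star_space.
Qed.

End Stabilizer.

(** * The two summands for the alternating group *)

Section AltHalves.

Variables (sA : (Alt_group 'I_(2 * m).+1) \subset [set: 'S_(2 * m).+1]).
Local Notation rA := (subg_repr rG sA).
Variables U1 U2 : 'M['F_2]_d.
Hypotheses (simU1 : mxsimple rA U1) (simU2 : mxsimple rA U2)
  (niso12 : ~ mx_iso rA U1 U2) (full12 : (U1 + U2 :=: 1%:M)%MS)
  (direct12 : (U1 :&: U2 = 0)%MS).

(** The translate of U1 is simple by Clifford theory. Its projections to U1 and U2 cannot both be
    nonzero, as U1 and U2 are not isomorphic. If it lay in U1, then U1 would be stable under the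
    full symmetric group, against irreducibility. *)
Lemma Alt_odd_swap i j : i != j -> (U1 *m R i j :=: U2)%MS.
Proof.
move=> ij; have nA : ((Alt_group 'I_(2 * m).+1) <| [set: 'S_(2 * m).+1])%g by exact: Alt_normal.
have sim1t : mxsimple rA (U1 *m R i j).
  have := @Clifford_simple _ _ _ _ nA _ rG U1 (tperm i j).
  by rewrite (bool_irrelevance (normal_sub nA) sA) => cs; apply: cs; rewrite ?in_setT.
have [mod1 nz1 min1] := simU1; have [mod2 nz2 min2] := simU2.
have direct21 : (U2 :&: U1 = 0)%MS by rewrite capmxC.
have hom1 : (U1 *m R i j <= dom_hom_mx rA (proj_mx U1 U2))%MS.
  by apply: submx_trans (proj_mx_hom direct12 mod1 mod2); rewrite full12 submx1.
have hom2 : (U1 *m R i j <= dom_hom_mx rA (proj_mx U2 U1))%MS.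
  by apply: submx_trans (proj_mx_hom direct21 mod2 mod1); rewrite addsmxC full12 submx1.
have decomp : U1 *m R i j *m proj_mx U1 U2 + U1 *m R i j *m proj_mx U2 U1 = U1 *m R i j.
  by apply: add_proj_mx; rewrite ?full12 ?submx1.
have [p2|nz] := eqVneq (U1 *m R i j *m proj_mx U2 U1) 0; last first.
  have iso2 := mx_Schur_iso sim1t simU2 hom2 (proj_mx_sub _ _ _) nz.
  have [p1|nz'] := eqVneq (U1 *m R i j *m proj_mx U1 U2) 0.
    move: decomp; rewrite p1 add0r => e; apply/eqmxP.
    have s : (U1 *m R i j <= U2)%MS by rewrite -e proj_mx_sub.
    rewrite s min2 //; first exact: mxsimple_module sim1t.
    by case: sim1t.
  have iso1 := mx_Schur_iso sim1t simU1 hom1 (proj_mx_sub _ _ _) nz'.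
  by case: niso12; apply: mx_iso_trans iso2; apply: mx_iso_sym.
have stable : (U1 *m R i j <= U1)%MS by rewrite -decomp p2 addr0 proj_mx_sub.
have modU1 : mxmodule rG U1.
  apply/mxmoduleP => g _.
  have even h : h \in (Alt_group 'I_(2 * m).+1) -> (U1 *m rG h <= U1)%MS.
    exact: (mxmoduleP mod1).
  have [|odd_g] := boolP (g \in (Alt_group 'I_(2 * m).+1)); first exact: even.
  rewrite -(mulgK (tperm i j) g) tpermV repr_permM mulmxA.
  apply: submx_trans stable; apply: submxMr; apply: even.
  by move: odd_g; rewrite !Alt_even odd_permM odd_tperm ij addbT negbK => ->.
have := spin_full modU1 nz1.
move=> U1full; case/negP: nz2; rewrite -submx0 -direct12 sub_capmx submx_refl andbT.
exact: submx_trans (submx1 _) U1full.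
Qed.

Lemma halves_decomp (v : 'rV_d) :
  exists v1 v2, [/\ (v1 <= U1)%MS, (v2 <= U2)%MS & v = v1 + v2].
Proof.
exists (v *m proj_mx U1 U2), (v *m proj_mx U2 U1).
by rewrite !proj_mx_sub add_proj_mx ?full12 ?submx1.
Qed.

Lemma halves_ext (A B : 'M_d) :
  (forall v : 'rV_d, (v <= U1)%MS -> v *m A = v *m B) ->
  (forall v : 'rV_d, (v <= U2)%MS -> v *m A = v *m B) -> A = B.
Proof.
move=> e1 e2; apply/row_matrixP => i; rewrite !rowE.
have [v1 [v2 [s1 s2 ->]]] := halves_decomp (delta_mx 0 i).
by rewrite !mulmxDl e1 ?e2.
Qed.

Lemma Alt_odd_swapC i j : i != j -> (U2 *m R i j :=: U1)%MS.
Proof.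
move=> ij; apply: eqmx_trans (eqmxMr _ (eqmx_sym (Alt_odd_swap ij))) _.
by rewrite -mulmxA repr_tperm_sq mulmx1.
Qed.

Lemma rank_half : \rank U1 = (2 ^ m.-1)%N.
Proof.
have [k kx] := other_point ord_max.
have e : \rank U1 = \rank U2.
  by rewrite -(Alt_odd_swap kx) mxrankMfree // row_free_unit repr_mx_unit ?in_setT.
have := mxrank_disjoint_sum direct12; rewrite full12 mxrank1 -e addnn -mul2n.
move/esym; rewrite [RHS]dim_spin ?spin_gt0 // -[in RHS](prednK m_gt0) expnS => /eqP.
by rewrite eqn_pmul2l // => /eqP.
Qed.

Lemma half_star x : (U1 *m star x <= U2)%MS.
Proof.
rewrite /star mulmx_sumr; apply: summx_sub => k kx.
by rewrite (@Alt_odd_swap x k) // eq_sym.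
Qed.

Lemma half_cap_star_space x : (U1 :&: star_space x = 0)%MS.
Proof.
apply/eqP/rowV0P => v; rewrite sub_capmx star_spaceE => /andP[v1 /eqP e].
apply/eqP; rewrite -submx0 -direct12 sub_capmx v1 -e /=.
by apply: submx_trans (half_star x); apply: submxMr.
Qed.

Local Notation P := (proj_mx U1 U2).

(** An odd permutation exchanges the summands, so it conjugates the projection P into the
    complementary one. Thus P and [quad x] have the same commutator with each [R x k]. *)
Lemma proj_tperm i j : i != j -> R i j *m P = (1%:M + P) *m R i j.
Proof.
move=> ij; apply: halves_ext => v vU;
  rewrite (mulmxA v (R i j)) (mulmxA v (1%:M + P)) mulmxDr mulmx1.
  rewrite (proj_mx_id direct12 vU) addrr_F2 mul0mx.
  by rewrite (proj_mx_0 direct12) // -(Alt_odd_swap ij) submxMr.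
rewrite (proj_mx_0 direct12 vU) addr0.
by rewrite (proj_mx_id direct12) // -(Alt_odd_swapC ij) submxMr.
Qed.

(** [P + quad x] commutes with the generators [R x k], hence is scalar. *)
Lemma proj_quad x : exists c, P = c%:M + quad x.
Proof.
have [|c e] := @centG (P + quad x); last by exists c; rewrite -e -addrA addrr_F2 addr0.
move=> g; suff : ([set: 'S_(2 * m).+1] \subset rcent rG (P + quad x))%g.
  by move=> /subsetP/(_ g (in_setT _)); rewrite inE => /andP[_ /eqP].
suff : (<<[set tperm x k | k in 'I_(2 * m).+1]>> \subset rcent rG (P + quad x))%g.
  by rewrite gen_tperm.
rewrite gen_subG; apply/subsetP => _ /imsetP[k _ ->]; rewrite inE in_setT /=.
have [->|kx] := eqVneq k x; first by rewrite tperm1 repr_mx1 mulmx1 mul1mx.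
rewrite mulmxDl mulmxDr proj_tperm 1?eq_sym // mulmxDl mul1mx.
have /(canRL (addKr_F2 _)) -> := quad_anticomm kx.
by rewrite [_ + R x k]addrC addrA [_ + R x k]addrC.
Qed.

End AltHalves.

(** * Isotropic and totally singular subspaces *)

Section Isotropy.

Variable f : {biscalar 'rV['F_2]_d}.
Hypothesis f_inv : forall g u v, f (u *m rG g) (v *m rG g) = f u v.

Lemma tperm_adj i j u v : f (u *m R i j) v = f u (v *m R i j).
Proof. by rewrite -[RHS](f_inv (tperm i j)) -mulmxA repr_tperm_sq mulmx1. Qed.

Lemma star_adj x u v : f (u *m star x) v = f u (v *m star x).
Proof.
rewrite !mulmx_sumr linear_sumlz linear_sumr.
by apply: eq_bigr => k _; rewrite tperm_adj.
Qed.

(** Transpositions are self-adjoint, so taking adjoints reverses each product and turns [quad] into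
    [quadT]. *)
Lemma quad_adj x u v : f (u *m quad x) v = f u (v *m (quad x + 1%:M)).
Proof.
have -> : quad x + 1%:M = quadT x by rewrite -(quad_rev x) addKr_F2.
rewrite !mulmx_sumr linear_sumlz linear_sumr; apply: eq_bigr => i _.
rewrite !mulmx_sumr linear_sumlz linear_sumr; apply: eq_bigr => j _.
by rewrite !mulmxA !tperm_adj.
Qed.

(** Write u as u' (1 + s_x) and move the self-adjoint factor 1 + s_x onto v, which it kills. *)
Lemma star_space_isotropic x u v :
  (u <= star_space x)%MS -> (v <= star_space x)%MS -> f u v = 0.
Proof.
move=> /star_space_sub[{}u ->]; rewrite star_spaceE => /eqP e.
rewrite mulmxDr mulmx1 linearDl star_adj e.
by rewrite -linearDr addrr_F2 linear0r.
Qed.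

Section Halves.

Variables (sA : (Alt_group 'I_(2 * m).+1) \subset [set: 'S_(2 * m).+1]).
Local Notation rA := (subg_repr rG sA).
Variables U1 U2 : 'M['F_2]_d.
Hypotheses (simU1 : mxsimple rA U1) (simU2 : mxsimple rA U2)
  (niso12 : ~ mx_iso rA U1 U2) (full12 : (U1 + U2 :=: 1%:M)%MS)
  (direct12 : (U1 :&: U2 = 0)%MS).

(** The projection P fixes u, and its adjoint P + 1 kills v. *)
Lemma half_isotropic u v : (u <= U1)%MS -> (v <= U1)%MS -> f u v = 0.
Proof.
move=> u1 v1; have [c eP] := proj_quad simU1 simU2 niso12 full12 direct12 ord_max.
have adj : f (u *m proj_mx U1 U2) v = f u (v *m (proj_mx U1 U2 + 1%:M)).
  rewrite eP -addrA !(mulmxDr _ c%:M) !mul_mx_scalar linearDl linearDr quad_adj.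
  by rewrite linearZl_LR linearZr_LR.
move: adj; rewrite mulmxDr mulmx1 !(proj_mx_id direct12) // addrr_F2.
by rewrite linear0r.
Qed.

End Halves.

Variable Q : 'rV['F_2]_d -> 'F_2.
Hypothesis Q_add : forall u v, Q (u + v) = Q u + Q v + f u v.
Hypothesis Q_inv : forall g v, Q (v *m rG g) = Q v.

Lemma isotropic_singular (W : 'M_d) i j k :
  i != j -> j != k -> i != k ->
  (W *m (R i j *m R j k) <= W)%MS -> (W *m (R j k *m R i j) <= W)%MS ->
  (forall u v, (u <= W)%MS -> (v <= W)%MS -> f u v = 0) ->
  totally_singular Q W.
Proof.
move=> ij jk ik W1 W2 isoW v vW.
rewrite -[v]mulmx1 -(three ij jk ik) mulmxDr Q_add isoW; first last.
- by apply: submx_trans W2; apply: submxMr.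
- by apply: submx_trans W1; apply: submxMr.
by rewrite -!repr_permM !Q_inv addr0; exact: F2_addrr.
Qed.

Hypothesis m_gt1 : (1 < m)%N.

(** This provides a 3-cycle that fixes [ord_max]. *)
Lemma pt012 : [/\ pt m 0 != pt m 1, pt m 1 != pt m 2, pt m 0 != pt m 2
  & forall k, (k < 3)%N -> pt m k != ord_max].
Proof.
have l3 : (3 < (2 * m).+1)%N by rewrite ltnS (leq_trans _ (leq_mul (leqnn 2) m_gt1)).
by split; rewrite ?pt_inj // ?(ltn_trans _ l3) // => k k3; rewrite pt_neq //= (leq_trans k3).
Qed.

Lemma star_space_singular x : totally_singular Q (star_space x).
Proof.
(* The 3-cycle on 0, 1, 2 stabilizes the space attached to [ord_max]; the other spaces are
   translates of that one. *)
have sing_max : totally_singular Q (star_space ord_max).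
  have [n01 n12 n02 nmax] := pt012.
  apply: (isotropic_singular n01 n12 n02) => [||u v]; last exact: star_space_isotropic.
    by rewrite mulmxA !(eqmxMr _ (star_spaceJ _ _)) !star_spaceJ !tpermD ?nmax.
  by rewrite mulmxA !(eqmxMr _ (star_spaceJ _ _)) !star_spaceJ !tpermD ?nmax.
move=> v; rewrite -{1}(tpermL ord_max x) -star_spaceJ => /submxP[u ->].
by rewrite mulmxA Q_inv sing_max // submxMl.
Qed.

Lemma Alt_half_singular (sA : (Alt_group 'I_(2 * m).+1) \subset [set: 'S_(2 * m).+1])
    (U1 U2 : 'M_d) : mxsimple (subg_repr rG sA) U1 -> mxsimple (subg_repr rG sA) U2 ->
  ~ mx_iso (subg_repr rG sA) U1 U2 -> (U1 + U2 :=: 1%:M)%MS -> (U1 :&: U2 = 0)%MS ->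
  totally_singular Q U1.
Proof.
move=> sim1 sim2 niso full direct; have [n01 n12 n02 _] := pt012.
have modU1 := mxsimple_module sim1.
apply: (isotropic_singular n01 n12 n02) => [||u v].
- by rewrite -repr_permM; apply: (mxmoduleP modU1); rewrite Alt_even odd_permM !odd_tperm n01 n12.
- by rewrite -repr_permM; apply: (mxmoduleP modU1); rewrite Alt_even odd_permM !odd_tperm n01 n12.
exact: (half_isotropic sim1 sim2 niso full direct).
Qed.

End Isotropy.

(** * Assembly of the spread *)

Lemma genmx_neq (A B : 'M['F_2]_d) :
  (A :&: B = 0)%MS -> (0 < \rank A)%N -> <<A>>%MS != <<B>>%MS.
Proof.
move=> cap0; apply: contraTneq => e; rewrite lt0n negbK mxrank_eq0.
by rewrite -submx0 -cap0 sub_capmx submx_refl -(genmxE B) -e genmxE submx_refl.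
Qed.

Lemma spread_of_spin_relations (Q : 'rV['F_2]_d -> 'F_2)
    (hQ : quadratic_form Q) (hQ_nondeg : nondegenerate_form Q)
    (hQ_inv : invariant_form rG Q) (m_gt1 : (1 < m)%N) (x : 'I_(2 * m).+1)
    (sA : (Alt_group 'I_(2 * m).+1) \subset [set: 'S_(2 * m).+1])
    (sH : point_stabilizer x \subset [set: 'S_(2 * m).+1])
    (U1 U2 : 'M_d)
    (hU1 : mxsimple (subg_repr rG sA) U1) (hU2 : mxsimple (subg_repr rG sA) U2)
    (hU12 : ~ mx_iso (subg_repr rG sA) U1 U2)
    (hsum : (U1 + U2 :=: 1%:M)%MS) (hdirect : mxdirect (U1 + U2)) :
  let U := module_socle (subg_repr rG sH) in
  totally_singular Q U1 /\ totally_singular Q U2 /\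
  forall g : 'I_(2 * m).+1 -> 'S_(2 * m).+1,
    g ord0 = 1%g ->
    (forall s : 'S_(2 * m).+1, exists! i, s \in (point_stabilizer x :* g i)%g) ->
    let spread := [set <<U *m rG (g i)>>%MS | i : 'I_(2 * m).+1]
                  :|: [set <<U1>>%MS; <<U2>>%MS] in
    partial_orthogonal_spread Q (2 ^ m.-1)%N spread /\ #|spread| = (2 * m + 3)%N.
Proof.
move=> U; case: (hQ) => _ [f [_ Q_add]].
have Q_inv g v : Q (v *m rG g) = Q v by apply: hQ_inv; rewrite in_setT.
have f_inv g u v : f (u *m rG g) (v *m rG g) = f u v.
  by apply: (addrI (Q u + Q v)); rewrite -Q_add -{1}(Q_inv g u) -{1}(Q_inv g v) -Q_add -mulmxDl.
have direct12 : (U1 :&: U2 = 0)%MS by apply/mxdirect_addsP.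
have direct21 : (U2 :&: U1 = 0)%MS by rewrite capmxC.
have hsum' : (U2 + U1 :=: 1%:M)%MS by rewrite addsmxC.
have hU21 : ~ mx_iso (subg_repr rG sA) U2 U1 by move/mx_iso_sym.
have sing1 := Alt_half_singular f_inv Q_add Q_inv m_gt1 hU1 hU2 hU12 hsum direct12.
have sing2 := Alt_half_singular f_inv Q_add Q_inv m_gt1 hU2 hU1 hU21 hsum' direct21.
do 2!split => //; move=> g _ gP spread.
have pow_gt0 : (0 < 2 ^ m.-1)%N by rewrite expn_gt0.
(* The translate of the socle by [g i] is the fixed space attached to the point [g i x]. *)
have eU i : <<U *m rG (g i)>>%MS = <<star_space (g i x)>>%MS.
  by apply: eq_genmx; exact: eqmx_trans (eqmxMr _ (socle_star_space sH)) (star_spaceJ _ _).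
have spreadP W : W \in spread ->
    [\/ exists y, W = <<star_space y>>%MS, W = <<U1>>%MS | W = <<U2>>%MS].
  rewrite !inE => /or3P[/imsetP[i _ ->]|/eqP->|/eqP->].
  - by rewrite eU; constructor 1; exists (g i x).
  - by constructor 2.
  - by constructor 3.
have rank1 := rank_half hU1 hU2 hU12 hsum direct12.
have rank2 := rank_half hU2 hU1 hU21 hsum' direct21.
have cap1 y := half_cap_star_space hU1 hU2 hU12 hsum direct12 y.
have cap2 y := half_cap_star_space hU2 hU1 hU21 hsum' direct21 y.
have cap1' y : (star_space y :&: U1 = 0)%MS by rewrite capmxC.
have cap2' y : (star_space y :&: U2 = 0)%MS by rewrite capmxC.
have gen_cap (A B : 'M_d) : (A :&: B = 0)%MS -> (<<A>> :&: <<B>> = 0)%MS.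
  by move=> AB; rewrite -genmx_cap AB genmx0.
split.
  split => //.
  - by rewrite -expnS prednK // -dim_spin ?spin_gt0.
  - by exists U1.
  - have genP (A : 'M_d) : \rank A = (2 ^ m.-1)%N -> totally_singular Q A ->
        \rank <<A>>%MS = (2 ^ m.-1)%N /\ totally_singular Q <<A>>%MS.
      by move=> rA sA'; rewrite genmxE; split=> // v; rewrite genmxE; apply: sA'.
    move=> W /spreadP[[y ->]|->|->]; apply: genP => //; first exact: rank_star_space.
    exact: (star_space_singular f_inv Q_add Q_inv m_gt1).
  - move=> W W' /spreadP[[y ->]|->|->] /spreadP[[y' ->]|->|->] neq; apply: gen_cap => //;
      try by rewrite eqxx in neq.
    by apply: star_space_cap; apply: contraNneq neq => ->.
rewrite cardsU cards2 genmx_neq ?rank1 // (_ : _ :&: _ = set0) ?cards0 ?subn0; last first.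
  apply/setP => W; rewrite !inE; apply/negbTE/negP => /andP[/imsetP[i _ ->]].
  by rewrite eU => /orP[]; apply/negP; apply: genmx_neq; rewrite ?rank_star_space.
rewrite card_imset ?card_ord ?addnS ?addSn //.
move=> i j; rewrite !eU => e.
have {}e : g i x = g j x.
  apply/eqP; move/eqP: e; apply: contraLR => /star_space_cap c.
  by rewrite genmx_neq ?rank_star_space.
(* If [g i] and [g j] send x to the same point, then [g j] lies in the cosets of both, so i = j. *)
have [k [_ uniq_k]] := gP (g j); rewrite -(uniq_k i) ?(uniq_k j) //.
- by rewrite mem_rcoset mulgV group1.
- by rewrite mem_rcoset point_stabilizerE permM -e permK.
Qed.

End SpinRelations.

(** * Two-row polytabloids as affine subspaces *)

Section Columns.

Variable m : nat.
Local Notation n := (2 * m).+1.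

Lemma half_ord_le (x : 'I_n) : (x./2 < m.+1)%N.
Proof. by have := ltn_ord x; lia. Qed.

Definition column (x : 'I_n) : 'I_m.+1 := Ordinal (half_ord_le x).

(** The other symbol of the column. At [ord_max], which has none, the argument of [pt] is out of
    range and the value is a mere default. *)
Definition mate (x : 'I_n) : 'I_n := pt m (if odd x then x.-1 else x.+1).

Lemma val_mate x : x != ord_max -> mate x = (if odd x then x.-1 else x.+1) :> nat.
Proof.
by rewrite -val_eqE /= => xm; rewrite val_pt //; have := ltn_ord x; case: ifP; lia.
Qed.

Lemma column_eq x y : (column y == column x) && (y != x) = (x != ord_max) && (y == mate x).
Proof.
have := ltn_ord x; have := ltn_ord y.
have [->|xm] /= := eqVneq x ord_max; first by rewrite -!val_eqE /=; lia.
by move: (xm); rewrite -!val_eqE /= val_mate //; case: ifP; lia.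
Qed.

Section ColumnSums.

Variable R : nzSemiRingType.
Implicit Types (u : 'I_n -> R) (j : 'I_m.+1).

(* The last column has a single symbol; the summand 1 stands for its missing mate. *)
Definition column_sum u j : R := \sum_(x | column x == j) u x + (j == ord_max)%:R.

Definition mate_value u x : R := if x == ord_max then 1 else u (mate x).

Lemma column_sumE u x : column_sum u (column x) = u x + mate_value u x.
Proof.
rewrite /column_sum (bigD1 x) //= -addrA; congr (_ + _).
rewrite (eq_bigl _ _ (column_eq x)) /mate_value.
have [->|xm] /= := eqVneq x ord_max.
  by rewrite big_pred0_eq add0r -val_eqE /= mul2n doubleK eqxx.
rewrite big_pred1_eq (_ : _ == _ = false) ?addr0 //.
apply: contraNF xm => /eqP/(congr1 val) /= e.
by rewrite -val_eqE /=; have := ltn_ord x; lia.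
Qed.

(** Over [F_2], the indicator of the functions that take both values on every two-symbol column and
    0 at [ord_max]. *)
Definition transversal u : R := \prod_j column_sum u j.

End ColumnSums.

Lemma F2_cases (a : 'F_2) : {a = 0} + {a = 1}.
Proof. by case: a => [[|[|?]] //] i; [left | right]; apply: val_inj. Qed.

Lemma F2_natr (a : 'F_2) : (a : nat)%:R = a.
Proof. by case: (F2_cases a) => ->. Qed.

Lemma mate_valueE (R : nzSemiRingType) (u : 'I_n -> R) x y :
  column y = column x -> y != x -> mate_value u x = u y.
Proof.
move=> exy nxy; have := column_eq x y; rewrite exy eqxx nxy => /esym/andP[xm /eqP ->].
by rewrite /mate_value (negbTE xm).
Qed.

Lemma mate_value_comp (R : nzSemiRingType) (u : 'I_n -> R) c x :
  (forall y, column y = column x -> y != x -> c y = y) ->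
  mate_value (u \o c) x = mate_value u x.
Proof.
move=> cx; rewrite /mate_value; have [//|xm] := eqVneq x ord_max.
have := column_eq x (mate x); rewrite xm eqxx => /andP[/eqP e ne].
by rewrite /= cx.
Qed.

Lemma column_surj (j : 'I_m.+1) : exists x, column x = j.
Proof.
have := ltn_ord j; rewrite ltnS => jm; exists (pt m (2 * j)).
by apply: val_inj; rewrite /= val_pt; lia.
Qed.

Definition bits (u : 'I_n -> 'F_2) x : nat := u x.

Lemma bits_le1 u x : (bits u x <= 1)%N.
Proof. by rewrite /bits; case: (F2_cases (u x)) => ->. Qed.

Lemma mate_bits_le1 u x : (mate_value (bits u) x <= 1)%N.
Proof. by rewrite /mate_value; case: eqP => // _; apply: bits_le1. Qed.

Lemma column_sum_bits u j : (column_sum (bits u) j)%:R = column_sum u j.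
Proof.
rewrite /column_sum natrD natr_sum; congr (_ + _); last by case: eqP.
by apply: eq_bigr => x _; apply: F2_natr.
Qed.

(** The sum of two bits is 1 as soon as it is odd. *)
Lemma column_bits1 u j : column_sum u j != 0 -> column_sum (bits u) j = 1%N.
Proof.
have [x <-] := column_surj j; rewrite -column_sum_bits column_sumE.
move: (bits_le1 u x) (mate_bits_le1 u x).
by move: (bits u x) (mate_value _ _) => [|[|a]] [|[|b]].
Qed.

Lemma sum_column_bits u : (\sum_j column_sum (bits u) j = (\sum_x bits u x).+1)%N.
Proof.
rewrite /column_sum big_split /= -[RHS]addn1; congr (_ + _)%N.
  by rewrite (partition_big column xpredT).
by rewrite (bigD1 ord_max) //= eqxx big1 // => j /negbTE ->.
Qed.

(** The m + 1 column sums all equal 1, and one unit comes from the missing mate. Hence every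
    transversal function is the row function of a tabloid. *)
Lemma transversal_weight u : transversal u != 0 -> (\sum_x bits u x = m)%N.
Proof.
move=> /prodf_neq0 tu; apply: succn_inj; rewrite -sum_column_bits.
rewrite (eq_bigr (fun=> 1%N)) => [|j _]; last by rewrite column_bits1 ?tu.
by rewrite sum1_card card_ord.
Qed.

(** The 3-cycle p to r to q to p; exchanging the arguments p and r gives the inverse cycle. *)
Definition rotation (c : 'I_n -> 'I_n) p q r :=
  [/\ c p = r, c q = p, c r = q & forall x, x != p -> x != q -> x != r -> c x = x].

Lemma column_sum_comp (R : nzSemiRingType) (u : 'I_n -> R) c j :
  (forall x, column x = j -> c x = x) -> column_sum (u \o c) j = column_sum u j.
Proof.
by move=> cj; congr (_ + _); apply: eq_bigr => x /eqP/cj /= ->.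
Qed.

(** With a, b, c, o the values at p, q, r and the mate of r, this is (a+b)(c+o) + (c+a)(b+o) +
    (b+c)(a+o) = 0, times the product over the unaffected columns. *)
Lemma transversal_rot_same (u : 'I_n -> 'F_2) p q r c1 c2 : p != q -> r != p -> r != q ->
  column p = column q -> column r != column p ->
  rotation c1 p q r -> rotation c2 r q p ->
  transversal u + transversal (u \o c1) + transversal (u \o c2) = 0.
Proof.
move=> pq rp rq epq nrp [c1p c1q c1r c1x] [c2r c2q c2p c2x].
have split_at (v : 'I_n -> 'F_2) : transversal v
    = column_sum v (column p) * (column_sum v (column r) *
    \prod_(j | (j != column p) && (j != column r)) column_sum v j).
  by rewrite /transversal (bigD1 (column p)) //= (bigD1 (column r)).
have rest c : (forall x, x != p -> x != q -> x != r -> c x = x) ->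
    \prod_(j | (j != column p) && (j != column r)) column_sum (u \o c) j
    = \prod_(j | (j != column p) && (j != column r)) column_sum u j.
  move=> cx; apply: eq_bigr => j /andP[jp jr]; apply: column_sum_comp => x ex.
  by apply: cx; [apply: contraNneq jp | apply: contraNneq jp | apply: contraNneq jr];
    move=> e; rewrite -ex e ?epq.
have mater c : (forall x, x != p -> x != q -> x != r -> c x = x) ->
    mate_value (u \o c) r = mate_value u r.
  move=> cx; apply: mate_value_comp => y ey yr; apply: cx => //.
    by apply: contraNneq nrp => e; rewrite -ey e.
  by apply: contraNneq nrp => e; rewrite epq -ey e.
rewrite !split_at !column_sumE.
rewrite !(@mate_valueE _ _ p q) //; try by rewrite eq_sym.
rewrite !rest //; last by move=> x *; apply: c2x.
rewrite !mater //; last by move=> x *; apply: c2x.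
rewrite /= c1p c1q c1r c2p c2q c2r.
move: (\prod_(j | _) _) (mate_value u r) => G o.
by case: (F2_cases (u p)) => ->; case: (F2_cases (u q)) => ->; case: (F2_cases (u r)) => ->;
  case: (F2_cases o) => ->; case: (F2_cases G) => ->; apply/eqP.
Qed.

Lemma transversal_rot_distinct (u : 'I_n -> 'F_2) p q r c1 c2 :
  column q != column p -> column r != column p -> column r != column q ->
  (\sum_x bits u x = m)%N ->
  rotation c1 p q r -> rotation c2 r q p ->
  transversal u + transversal (u \o c1) + transversal (u \o c2)
    = \prod_(j | (j != column p) && (j != column q) && (j != column r)) column_sum u j.
Proof.
move=> qp rp rq wt [c1p c1q c1r c1x] [c2r c2q c2p c2x].
have split_at (v : 'I_n -> 'F_2) : transversal v
    = column_sum v (column p) * (column_sum v (column q) * (column_sum v (column r) *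
    \prod_(j | (j != column p) && (j != column q) && (j != column r)) column_sum v j)).
  rewrite /transversal (bigD1 (column p)) //= (bigD1 (column q)) //=.
  by rewrite (bigD1 (column r)) //= rp rq.
have rest c : (forall x, x != p -> x != q -> x != r -> c x = x) ->
    \prod_(j | (j != column p) && (j != column q) && (j != column r)) column_sum (u \o c) j
    = \prod_(j | (j != column p) && (j != column q) && (j != column r)) column_sum u j.
  move=> cx; apply: eq_bigr => j /andP[/andP[jp jq] jr]; apply: column_sum_comp => x ex.
  by apply: cx; [apply: contraNneq jp | apply: contraNneq jq | apply: contraNneq jr];
    move=> e; rewrite -ex e.
have mates c x : (forall x, x != p -> x != q -> x != r -> c x = x) ->
    x \in [:: p; q; r] -> mate_value (u \o c) x = mate_value u x.
  move=> cx xpqr; apply: mate_value_comp => y ey yx.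
  have ne z : column z != column x -> y != z by apply: contraNneq => e; rewrite -ey e.
  move: xpqr; rewrite !inE => /or3P[]/eqP e; rewrite e in ne yx; apply: cx => //;
    by apply: ne => //; rewrite eq_sym.
have := sum_column_bits u; rewrite wt (bigD1 (column p)) //= (bigD1 (column q)) //=.
rewrite (bigD1 (column r)) /= ?rp ?rq //.
rewrite !split_at !rest //; last by move=> x *; apply: c2x.
rewrite !column_sumE !mates ?inE ?eqxx ?orbT //; try by move=> x *; apply: c2x.
rewrite /= c1p c1q c1r c2p c2q c2r.
(* If another column has sum 0, both sides vanish. Otherwise the m - 2 other columns use up m - 2 of
   the total m + 1, which leaves 3 for the six values in the columns of p, q, r. *)
have [G0|G1] := F2_cases
    (\prod_(j | (j != column p) && (j != column q) && (j != column r)) column_sum u j).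
  by rewrite G0 !mulr0 !addr0.
have cardJ : #|[set column p; column q; column r]| = 3.
  by rewrite -setUA cardsU1 !inE cards2 ![_ == column r]eq_sym ![column p == _]eq_sym
    (negbTE qp) (negbTE rp) rq.
have m3 : (2 < m.+1)%N.
  by have := max_card (mem [set column p; column q; column r]); rewrite cardJ card_ord.
have -> : (\sum_(j | (j != column p) && (j != column q) && (j != column r))
    column_sum (bits u) j = m.+1 - 3)%N.
  rewrite (eq_bigr (fun=> 1%N)) => [|j Jj]; last first.
    apply: column_bits1; apply: contra_eqN G1 => /eqP j0.
    by rewrite (bigD1 j) //= j0 mul0r eq_sym oner_eq0.
  rewrite sum1dep_card; transitivity #|~: [set column p; column q; column r]|.
    by apply: eq_card => j; rewrite !inE !negb_or.
  by rewrite cardsCs setCK card_ord cardJ.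
move=> e; have {}e : (bits u p + mate_value (bits u) p + (bits u q + mate_value (bits u) q
    + (bits u r + mate_value (bits u) r)) = 3)%N.
  apply/eqP; rewrite -(eqn_add2r (m.+1 - 3)) (subnKC m3) -[X in _ == X]e; apply/eqP.
  by rewrite -!addnA.
rewrite G1 !mulr1.
have natv x : bits u x = u x by [].
have bv v : (mate_value (bits u) v)%:R = mate_value u v.
  by rewrite /mate_value; case: eqP => // _; apply: F2_natr.
rewrite -!bv; move: (mate_bits_le1 u p) (mate_bits_le1 u q) (mate_bits_le1 u r) e.
rewrite !natv.
(* With total 3, the values at p, q, r are complementary to those of the mates for exactly one of
   the three rotations, or for all of them: an odd number. *)
by case: (F2_cases (u p)) => ->; case: (F2_cases (u q)) => ->; case: (F2_cases (u r)) => ->;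
  move: (mate_value _ p) (mate_value _ q) (mate_value _ r) => [|[|a]] [|[|b]] [|[|c]] // _ _ _ _;
  apply/eqP.
Qed.

(** Translation by v pairs the vectors with coordinate 0 with those with coordinate 1, at a place
    where v is nonzero. *)
Lemma sum_invariant k (F : 'rV['F_2]_k -> 'F_2) v :
  v != 0 -> (forall u, F (u + v) = F u) -> \sum_u F u = 0.
Proof.
move=> /rV0Pn[x vx] Fv; rewrite (bigID (fun u : 'rV_k => u 0 x == 0)) /=.
rewrite [X in _ + X](_ : _ = \sum_(u : 'rV_k | u 0 x == 0) F u); first exact: F2_addrr.
rewrite (reindex_inj (addIr v)) /=; apply: eq_big => u //.
rewrite !mxE; case: (F2_cases (v 0 x)) vx => -> //.
by case: (F2_cases (u 0 x)) => ->.
Qed.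

Lemma common_kernel k (s : seq 'cV['F_2]_k) : (size s < k)%N ->
  exists2 v : 'rV_k, v != 0 & forall l, l \in s -> v *m l = 0.
Proof.
move=> sk; pose A := \matrix_(x < k, i < size s) s`_i x 0.
have /rowV0Pn[v vA nzv] : kermx A != 0.
  by rewrite kermx_eq0 -row_leq_rank -ltnNge (leq_ltn_trans (rank_leq_col A)).
exists v => // l /(nthP 0)[i lt_i <-]; apply/colP => j; rewrite (ord1 j).
move/sub_kermxP/rowP: vA => /(_ (Ordinal lt_i)); rewrite !mxE => e.
by rewrite -[RHS]e; apply: eq_bigr => y _; rewrite !mxE.
Qed.

(* The affine forms number at most 2m - 1, so that they have a common period. *)
Lemma sum_transversals (J : {set 'I_m.+1}) (g : 'S_n) : (2 < #|J|)%N ->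
  \sum_(u : 'rV['F_2]_n)
    (\prod_(j | j \notin J) column_sum (u 0) j) * transversal (u 0 \o g) = 0.
Proof.
(* [l h j] is the linear part of the affine form sending u to [column_sum (u \o h) j]; vectors in
   its kernel are periods of that form. *)
move=> J3; pose l (h : 'S_n) j : 'cV['F_2]_n := \col_y (column (h^-1%g y) == j)%:R.
have lE (h : 'S_n) j (u v : 'rV_n) : v *m l h j = 0 ->
    column_sum ((u + v) 0 \o h) j = column_sum (u 0 \o h) j.
  move=> vl; congr (_ + _); under eq_bigr do rewrite /= mxE.
  rewrite big_split /= [X in _ + X](_ : _ = 0) ?addr0 //.
  have /colP/(_ 0) := vl; rewrite !mxE => e; rewrite -[RHS]e.
  rewrite [RHS](reindex_inj (@perm_inj _ h)) /= [LHS]big_mkcond; apply: eq_bigr => y _.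
  by rewrite mxE permK; case: eqP; rewrite ?mulr1 ?mulr0.
have [|v nzv vl] := @common_kernel n ([seq l 1%g j | j in ~: J] ++ [seq l g j | j : 'I_m.+1]).
  have cJ : #|~: J| = (m.+1 - #|J|)%N by rewrite cardsCs setCK card_ord.
  have Jm : (#|J| <= m.+1)%N by rewrite -[X in (_ <= X)%N](card_ord m.+1) max_card.
  rewrite size_cat !size_image cJ card_ord; move: J3 Jm; set k := #|J|; lia.
apply: (sum_invariant nzv) => u; congr (_ * _).
  apply: eq_bigr => j Jj; have e w : column_sum (w 0) j = column_sum (w 0 \o (1%g : 'S_n)) j.
    by congr (_ + _); apply: eq_bigr => x _; rewrite /= perm1.
  rewrite !e lE // vl // mem_cat; apply/orP; left.
  by apply/imageP; exists j; rewrite ?inE.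
apply: eq_bigr => j _; rewrite lE // vl // mem_cat; apply/orP; right.
by apply/imageP; exists j.
Qed.

End Columns.

Lemma double_bit_inj a b c d : (a < 2 -> b < 2 ->
  2 * c + a = 2 * d + b -> c = d /\ a = b)%N.
Proof. lia. Qed.

(** * Tabloids and polytabloids of shape (m+1, m) *)

Section Tabloids.

Variable m : nat.
Local Notation n := (2 * m).+1.
Local Notation la := [:: m.+1; m].
Local Notation tabm := (tabloid n la).

Definition bit (t : tabm) (x : 'I_n) : 'F_2 := (val t x : nat)%:R.

Lemma bits_bit t x : bits (bit t) x = val t x.
Proof. by rewrite /bits /bit; case: (val t x) => [[|[|]]]. Qed.

Lemma bit_inj t t' : bit t =1 bit t' -> t = t'.
Proof.
move=> e; apply/val_inj/ffunP => x; apply: ord_inj.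
by rewrite -!bits_bit /bits e.
Qed.

Lemma bit_act t s x : bit (tabloid_act t s^-1%g) x = bit t (s x).
Proof. by rewrite /bit /= ffunE invgK. Qed.

Lemma bit_weight t : (\sum_x bits (bit t) x = m)%N.
Proof.
have /forallP/(_ (inord 1))/eqP := valP t.
have -> : nth 0%N la (inord 1 : 'I_(size la)) = m by rewrite inordK.
move=> e; rewrite -[RHS]e -sum1dep_card [RHS]big_mkcond /=; apply: eq_bigr => x _.
rewrite bits_bit -val_eqE /= inordK //.
by case: (val t x) => [[|[|]]].
Qed.

Lemma bit_surj (u : 'I_n -> 'F_2) : (\sum_x bits u x = m)%N -> exists t, bit t =1 u.
Proof.
move=> wu; pose row x : 'I_(size la) := inord (bits u x).
have rowE x : row x = bits u x :> nat by rewrite inordK // ltnS bits_le1.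
have c1 : #|[set x | row x == 1%N :> nat]| = m.
  rewrite -[RHS]wu -sum1dep_card big_mkcond; apply: eq_bigr => x _.
  by rewrite rowE; have := bits_le1 u x; case: (bits u x) => [|[]].
have P : [forall i, #|[set x | [ffun x => row x] x == i]| == nth 0%N la i].
  apply/forallP => -[[|[|i]] //= lti].
    have := cardsC [set x | row x == 1%N :> nat]; rewrite c1 card_ord => e.
    apply/eqP; transitivity #|~: [set x | row x == 1%N :> nat]|; last by move: e; lia.
    apply: eq_card => x; rewrite !inE ffunE -val_eqE /= rowE.
    by have := bits_le1 u x; case: (bits u x) => [|[]].
  rewrite -[X in _ == X]c1; apply/eqP; apply: eq_card => x.
  by rewrite !inE ffunE -val_eqE.
exists (exist (fun t : {ffun 'I_n -> 'I_(size la)} =>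
  [forall i, #|[set x | t x == i]| == nth 0%N la i]) _ P) => x.
rewrite /bit /= ffunE rowE; exact: F2_natr.
Qed.

(** [bit] identifies tabloids with vectors of weight m, so scalar products of polytabloids become
    sums over a whole vector space. *)
Lemma sum_tabloids (F : 'rV['F_2]_n -> 'F_2) :
  (forall u, F u != 0 -> (\sum_x bits (u 0%R) x = m)%N) ->
  \sum_(t : tabm) F (\row_x bit t x) = \sum_u F u.
Proof.
move=> Fm; pose f (t : tabm) : 'rV['F_2]_n := \row_x bit t x.
have f_inj : injective f.
  by move=> t t' /rowP e; apply: bit_inj => x; have := e x; rewrite !mxE.
rewrite [RHS](bigID (mem (f @: setT))) /= [X in _ = _ + X]big1 ?addr0; last first.
  move=> u; apply: contraNeq => /Fm/bit_surj[t e]; apply/imsetP; exists t => //.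
  by apply/rowP => x; rewrite mxE e.
by rewrite big_imset /=; [apply: eq_bigl => t; rewrite inE | move=> t t' _ _; apply: f_inj].
Qed.

Lemma odd_lt_size (x : 'I_n) : (odd x < size la)%N.
Proof. by case: odd. Qed.

Lemma half_lt (x : 'I_n) : (x./2 < n)%N.
Proof. by have := ltn_ord x; lia. Qed.

Definition std_fun (x : 'I_n) : 'I_(size la) * 'I_n :=
  (Ordinal (odd_lt_size x), Ordinal (half_lt x)).

Lemma std_proof : injectiveb (finfun std_fun)
  && [forall x, ((finfun std_fun) x).2 < nth 0%N la ((finfun std_fun) x).1]%N.
Proof.
apply/andP; split.
  apply/injectiveP => x y; rewrite !ffunE => -[eo eh]; apply: ord_inj.
  by rewrite -(odd_double_half x) -(odd_double_half y) eo eh.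
apply/forallP => x; rewrite ffunE /=; have := ltn_ord x.
by case: (boolP (odd x)) => ox /=; lia.
Qed.

Definition std_tableau : tableau n la :=
  exist (fun T : {ffun 'I_n -> 'I_(size la) * 'I_n} =>
    injectiveb T && [forall x, (T x).2 < nth 0 la (T x).1]%N) _ std_proof.

Lemma std_tableauE x : val std_tableau x = std_fun x.
Proof. by rewrite /= ffunE. Qed.

(** The boxes are numbered by 2 (column) + (row), as in [std_tableau]. *)
Lemma tableau_std (T : tableau n la) : exists s, T = tableau_act std_tableau s.
Proof.
have /andP[/injectiveP injT /forallP ltT] := valP T.
pose h x : 'I_n := pt m (2 * (val T x).2 + (val T x).1).
have hE x : h x = (2 * (val T x).2 + (val T x).1)%N :> nat.
  rewrite /h val_pt //; have := ltT x; case: (val T x) => [[[|[|r]] //= ltr] c] /=; lia.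
have h_inj : injective h.
  move=> x y /(congr1 val) /=; rewrite !hE => e; apply: injT.
  move: e; case: (val T x) => [r c]; case: (val T y) => [r' c'] /= e.
  have := ltn_ord r; have := ltn_ord r'; rewrite /= => lr lr'.
  by congr (_, _); apply: ord_inj; lia.
exists (perm h_inj)^-1%g; apply: val_inj; apply/ffunP => x.
rewrite /= !ffunE invgK permE /std_fun.
have := hE x; case: (val T x) => [r c] /= e; have := ltn_ord r; rewrite /= => lr.
by congr (_, _); apply: ord_inj; rewrite /= e; lia.
Qed.

Definition std_poly : 'rV['F_2]_(#|{: tabm}|) := polytabloid 'F_2 std_tableau.

(** Signs are trivial over [F_2]. A transversal tabloid arises from exactly one column permutation,
    any other tabloid from none. *)
Lemma std_polyE j : std_poly 0 j = transversal (bit (enum_val j)).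
Proof.
set t := enum_val j; rewrite /std_poly mxE -/t.
have inC (p : 'S_n) : reflect (forall x, (p x)./2 = x./2) (p \in column_stabilizer std_tableau).
  rewrite inE; apply: (iffP forallP) => Cp x; last by rewrite !std_tableauE -val_eqE /= Cp.
  by have /eqP/(congr1 val) := Cp x; rewrite !std_tableauE.
have rowsP (p : 'S_n) : reflect (forall x, odd (p^-1%g x) = val t x :> nat)
    ([ffun x => (val std_tableau (p^-1%g x)).1] == val t).
  apply: (iffP eqP) => [/ffunP e x|e].
    by have := congr1 val (e x); rewrite ffunE std_tableauE.
  by apply/ffunP => x; rewrite ffunE std_tableauE; apply: ord_inj; apply: e.
have N1 : -1 = 1 :> 'F_2 by apply/eqP.
under eq_bigr do rewrite N1 expr1n mul1r.
have [tr0|tr1] := F2_cases (transversal (bit t)).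
  rewrite tr0 big1 // => p /inC Cp; case: rowsP => // e; exfalso.
  have bitE x : bit t x = (odd (p^-1%g x))%:R by rewrite /bit -e.
  have Cp' x : (p^-1%g x)./2 = x./2 by rewrite -{2}(permKV p x) Cp.
  suff : transversal (bit t) != 0 by rewrite tr0 eqxx.
  apply/prodf_neq0 => k _; have [x <-] := column_surj k; rewrite column_sumE bitE.
  have [xm|xm] := eqVneq x ord_max.
    have -> : (p^-1)%g x = x.
      apply: ord_inj; have := Cp' x; have := ltn_ord (p^-1%g x).
      by rewrite xm /=; lia.
    by rewrite /mate_value xm eqxx /= mul2n odd_double.
  have := column_eq x (mate x); rewrite xm eqxx => /andP[/eqP/(congr1 val) /= eh ne].
  rewrite /mate_value (negbTE xm) bitE.
  have ne' : (p^-1)%g (mate x) != (p^-1)%g x by rewrite (inj_eq perm_inj).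
  have : odd ((p^-1)%g (mate x)) != odd ((p^-1)%g x).
    apply: contraNneq ne' => eo; apply/eqP/ord_inj.
    by rewrite -[LHS]odd_double_half -[RHS]odd_double_half eo !Cp' eh.
  by case: odd; case: odd.
rewrite tr1; have /prodf_neq0 tr : transversal (bit t) != 0 by rewrite tr1.
(* The map q below sends a symbol to the box of its own column in the row prescribed by t; its
   inverse is the column permutation sought. At [ord_max] only row 0 is in range, as transversality
   ensures. *)
have qlt (x : 'I_n) : (2 * x./2 + val t x < n)%N.
  have [xm|xm] := eqVneq x ord_max; last first.
    have := ltn_ord (val t x); have := ltn_ord x; move: xm; rewrite -val_eqE /=; lia.
  have := tr (column x) isT; rewrite column_sumE /mate_value xm eqxx -xm -bits_bit.
  rewrite /bits; have := ltn_ord x.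
  by case: (F2_cases (bit t x)) => ->; rewrite // addn0; lia.
pose q x : 'I_n := Ordinal (qlt x).
have q_inj : injective q.
  move=> x y /(congr1 val) /= e; apply/eqP/idPn => xy.
  have lx : (val t x < 2)%N := ltn_ord _; have ly : (val t y < 2)%N := ltn_ord _.
  have exy : column y = column x.
    by have [e1 _] := double_bit_inj lx ly e; apply: ord_inj.
  have := tr (column x) isT; rewrite column_sumE (mate_valueE _ exy) 1?eq_sym //.
  have [_ e2] := double_bit_inj lx ly e.
  by rewrite (_ : bit t y = bit t x) ?F2_addrr ?eqxx // /bit e2.
have qV x : ((perm q_inj)^-1%g^-1)%g x = q x by rewrite invgK permE.
have th (k : 'I_n) : odd (q k) = val t k :> nat.
  rewrite /= oddD oddM /=; have := ltn_ord (val t k); rewrite /= .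
  by case: (nat_of_ord (val t k)) => [|[|]].
have qh (x : 'I_n) : (q x)./2 = x./2 by have := ltn_ord (val t x); rewrite /=; lia.
rewrite (bigD1 (perm q_inj)^-1%g) /=; last first.
  by apply/inC => x; rewrite -{2}(permKV (perm q_inj) x) permE qh.
rewrite (introT (rowsP _)); last by move=> x; rewrite qV th.
rewrite big1 ?addr0 // => p /andP[/inC Cp]; case: rowsP => // e; case/eqP.
apply: (inv_inj invgK); rewrite invgK; apply/permP => x; apply: ord_inj.
by rewrite permE -[LHS]odd_double_half e -{1}(Cp (p^-1 x)%g) permKV /= -mul2n addnC.
Qed.

Lemma prod_pairsE (u : 'I_n -> 'F_2) :
  \prod_(0 <= l < m) (u (pt m (2 * l)) + u (pt m (2 * l).+1))
    = \prod_(l < m) column_sum u (widen_ord (leqnSn m) l).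
Proof.
rewrite big_mkord; apply: eq_bigr => l _; have lm := ltn_ord l.
have va : pt m (2 * l) = (2 * l)%N :> nat by rewrite val_pt; lia.
have vb : pt m (2 * l).+1 = (2 * l).+1 :> nat by rewrite val_pt; lia.
have -> : widen_ord (leqnSn m) l = column (pt m (2 * l)).
  by apply: ord_inj; rewrite /= va; lia.
rewrite column_sumE (@mate_valueE _ _ _ _ (pt m (2 * l).+1)) //.
  by apply: ord_inj; rewrite /= va vb; lia.
by rewrite -val_eqE /= va vb; lia.
Qed.

Lemma column_sum_max (R : nzSemiRingType) (u : 'I_n -> R) :
  column_sum u ord_max = u ord_max + 1.
Proof.
have -> : (ord_max : 'I_m.+1) = column (ord_max : 'I_n).
  by apply: ord_inj => /=; lia.
by rewrite column_sumE /mate_value eqxx.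
Qed.

Lemma transversalE (u : 'I_n -> 'F_2) : transversal u
  = \prod_(0 <= l < m) (u (pt m (2 * l)) + u (pt m (2 * l).+1)) * (u ord_max + 1).
Proof. by rewrite /transversal big_ord_recr -column_sum_max prod_pairsE. Qed.

(** The m pairs already account for the whole weight m. *)
Lemma bit_max t : \prod_(0 <= l < m) (bit t (pt m (2 * l)) + bit t (pt m (2 * l).+1)) != 0 ->
  bit t ord_max = 0.
Proof.
rewrite prod_pairsE => /prodf_neq0 nz; have := sum_column_bits (bit t).
rewrite bit_weight big_ord_recr (eq_bigr (fun=> 1%N)) => [|l _]; last first.
  exact: column_bits1 (nz l isT).
rewrite sum1_card card_ord column_sum_max /bits; case: (F2_cases (bit t ord_max)) => -> //.
by rewrite /= -[RHS]addn1 => /addnI.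
Qed.

Local Notation permr := (tabloid_repr 'F_2 n la).

Lemma mul_permr k (A : 'M_(k, #|{: tabm}|)) s i j :
  (A *m permr s) i j = A i (enum_rank (tabloid_act (enum_val j) s^-1%g)).
Proof. exact: mul_tabloid_mx. Qed.

(* The indicator of u x = v x. *)
Definition agree (u v : 'I_n -> 'F_2) x : 'F_2 := 1 + u x + v x.

(* Expanding the first k factors of pair_product turns the equations of the first k
   columns from t = u into t and u being both transversal. *)
Definition partial_product k (t u : 'I_n -> 'F_2) : 'F_2 :=
  \prod_(0 <= l < k) ((t (pt m (2 * l)) + t (pt m (2 * l).+1))
                     * (u (pt m (2 * l)) + u (pt m (2 * l).+1)))
  * \prod_(k <= l < m) (agree t u (pt m (2 * l)) * agree t u (pt m (2 * l).+1))
  * agree t u ord_max.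

Lemma eq_partial_product k t u u' : u =1 u' -> partial_product k t u = partial_product k t u'.
Proof.
move=> e; rewrite /partial_product /agree e; congr (_ * _ * _);
  by apply: eq_bigr => l _; rewrite !e.
Qed.

Lemma tperm_pt k c : (k < m)%N -> (c < n)%N -> c != (2 * k)%N -> c != (2 * k).+1 ->
  tperm (pt m (2 * k)) (pt m (2 * k).+1) (pt m c) = pt m c.
Proof.
by move=> km cn ca cb; rewrite tpermD // pt_inj //; lia.
Qed.

(** At k = 0 this is the indicator of t = u. Adding the swap of a pair (a, b) uses
    [t_a=u_a][t_b=u_b] + [t_a=u_b][t_b=u_a] = (t_a+t_b)(u_a+u_b) over [F_2]. *)
Lemma pair_product_entry k i j : (k <= m)%N ->
  pair_product permr k i j = partial_product k (bit (enum_val i)) (bit (enum_val j)).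
Proof.
elim: k i j => [|k IHk] i j km.
  rewrite /= /partial_product big_nil mul1r mxE.
  have agr (t : tabm) x : agree (bit t) (bit t) x = 1.
    by rewrite /agree -addrA F2_addrr addr0.
  have [->|ij] /= := eqVneq i j.
    by rewrite agr mulr1 big1 // => l _; rewrite !agr mulr1.
  apply/esym/eqP/idPn => nz; case/eqP: ij; apply: enum_val_inj; apply: bit_inj => x.
  have ag x' : agree (bit (enum_val i)) (bit (enum_val j)) x' != 0 ->
      bit (enum_val i) x' = bit (enum_val j) x'.
    rewrite /agree; case: (F2_cases (bit (enum_val i) x')) => ->;
    by case: (F2_cases (bit (enum_val j) x')) => ->.
  move: nz; rewrite mulf_eq0 negb_or big_mkord => /andP[/prodf_neq0 prod_nz max_nz].
  have [->|xm] := eqVneq x ord_max; first exact: ag max_nz.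
  have xlt : (x./2 < m)%N by have := ltn_ord x; move: xm; rewrite -val_eqE /=; lia.
  have := prod_nz (Ordinal xlt) isT; rewrite mulf_eq0 negb_or => /andP[na nb].
  have [ox|ox] := boolP (odd x).
    have ex : x = pt m (2 * x./2).+1 by apply: ord_inj; rewrite val_pt; lia.
    by have := ag _ nb; rewrite /= -ex.
  have ex : x = pt m (2 * x./2) by apply: ord_inj; rewrite val_pt; lia.
  by have := ag _ na; rewrite /= -ex.
rewrite [LHS]/= mulmxDr mulmx1 mxE mul_permr !IHk 1?ltnW // enum_rankK.
set t := bit _; set u := bit (enum_val j).
rewrite (eq_partial_product _ _ (bit_act _ _)) -/u.
set a := pt m (2 * k); set b := pt m (2 * k).+1.
have fix_ab := tperm_pt km; rewrite -/a -/b in fix_ab.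
have tpa l : (l < m)%N -> l != k -> tperm a b (pt m (2 * l)) = pt m (2 * l).
  by move=> lm lk; apply: fix_ab; lia.
have tpb l : (l < m)%N -> l != k -> tperm a b (pt m (2 * l).+1) = pt m (2 * l).+1.
  by move=> lm lk; apply: fix_ab; lia.
have tpz : tperm a b ord_max = ord_max.
  by rewrite tpermD // -val_eqE /= val_pt; lia.
rewrite /partial_product big_nat_recr //= !(big_ltn km) -/a -/b.
have -> : \prod_(0 <= l < k) ((t (pt m (2 * l)) + t (pt m (2 * l).+1))
    * ((u \o tperm a b) (pt m (2 * l)) + (u \o tperm a b) (pt m (2 * l).+1)))
    = \prod_(0 <= l < k) ((t (pt m (2 * l)) + t (pt m (2 * l).+1))
    * (u (pt m (2 * l)) + u (pt m (2 * l).+1))).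
  by apply: eq_big_nat => l /andP[_ lk]; rewrite /= tpa ?tpb //; lia.
have -> : \prod_(k.+1 <= l < m) (agree t (u \o tperm a b) (pt m (2 * l))
    * agree t (u \o tperm a b) (pt m (2 * l).+1))
    = \prod_(k.+1 <= l < m) (agree t u (pt m (2 * l)) * agree t u (pt m (2 * l).+1)).
  by apply: eq_big_nat => l /andP[lk lm]; rewrite /agree /= tpa ?tpb //; lia.
rewrite /agree /= tpz tpermL tpermR.
move: (\prod_(_ <= _ < k) _) (\prod_(_ <= _ < m) _) (1 + _ + u ord_max) => G H Z.
by case: (F2_cases (t a)) => ->; case: (F2_cases (t b)) => ->; case: (F2_cases (u a)) => ->;
  case: (F2_cases (u b)) => ->; case: (F2_cases G) => ->; case: (F2_cases H) => ->;
  case: (F2_cases Z) => ->; apply/eqP.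
Qed.

(** At k = m the column factors separate into a function of i times one of j. If both are nonzero,
    [bit_max] makes both tabloids 0 at [ord_max], where the remaining factors agree. *)
Lemma pair_product_permr : pair_product permr m = std_poly^T *m std_poly.
Proof.
apply/matrixP => i j; rewrite pair_product_entry // [RHS]mxE big_ord1 mxE.
rewrite !std_polyE !transversalE /partial_product [\prod_(m <= _ < m) _]big_geq // mulr1.
rewrite big_split /= /agree.
have [->|nzA] := eqVneq (\prod_(0 <= l < m) (bit (enum_val i) (pt m (2 * l))
  + bit (enum_val i) (pt m (2 * l).+1))) 0; first by rewrite !mul0r.
have [->|nzB] := eqVneq (\prod_(0 <= l < m) (bit (enum_val j) (pt m (2 * l))
  + bit (enum_val j) (pt m (2 * l).+1))) 0; first by rewrite !(mulr0, mul0r).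
by rewrite !bit_max // !addr0 !add0r !mulr1.
Qed.

Lemma eq_transversal (u v : 'I_n -> 'F_2) : u =1 v -> transversal u = transversal v.
Proof.
by move=> e; apply: eq_bigr => j _; congr (_ + _); apply: eq_bigr => x _.
Qed.

Lemma std_poly_act s j :
  (std_poly *m permr s) 0 j = transversal (bit (enum_val j) \o s).
Proof.
rewrite mul_permr std_polyE enum_rankK; apply: eq_transversal => x.
exact: bit_act.
Qed.

(** If two of p, q, r share a column, the first factor vanishes after a cyclic renaming. Otherwise
    it may be replaced by the product over the columns that p, q, r avoid, and [sum_transversals]
    applies. *)
Lemma sum_rotations p q r (c1 c2 s : 'S_n) : p != q -> q != r -> p != r ->
  rotation c1 p q r -> rotation c2 r q p ->
  \sum_(u : 'rV['F_2]_n) (transversal (u 0) + transversal (u 0 \o c1) + transversal (u 0 \o c2))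
    * transversal (u 0 \o s) = 0.
Proof.
move=> pq qr pr rot1 rot2.
have [qp rq rp] : [/\ q != p, r != q & r != p] by rewrite ![_ == p]eq_sym ![r == q]eq_sym.
have turn (c : 'I_n -> 'I_n) x y z : rotation c x y z -> rotation c y z x.
  by case=> cx cy cz cfix; split=> // w *; apply: cfix.
have rot1a := turn _ _ _ _ rot1.
have rot1b := turn _ _ _ _ rot1a.
have rot2a := turn _ _ _ _ rot2.
have rot2b := turn _ _ _ _ rot2a.
have [epq|npq] := eqVneq (column p) (column q).
  have [erp|nrp] := eqVneq (column r) (column p).
    have := column_eq p q; have := column_eq p r; rewrite -epq erp eqxx qp rp.
    move=> /esym/andP[_ /eqP er] /esym/andP[_ /eqP eq_]; by rewrite er eq_ eqxx in rq.
  by apply: big1 => u _; rewrite (transversal_rot_same _ pq rp rq epq nrp) // mul0r.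
have [eqr|nqr] := eqVneq (column q) (column r).
  by apply: big1 => u _; rewrite (transversal_rot_same _ qr pq pr eqr npq rot1a rot2b) mul0r.
have [erp|nrp] := eqVneq (column r) (column p).
  rewrite -erp in npq; rewrite eq_sym in npq.
  by apply: big1 => u _; rewrite (transversal_rot_same _ rp qr qp erp npq rot1b rot2a) mul0r.
pose J := [set column p; column q; column r].
have cardJ : #|J| = 3.
  by rewrite /J -setUA cardsU1 !inE cards2 (negbTE npq) [_ == column r]eq_sym (negbTE nrp) nqr.
rewrite -[RHS](sum_transversals (J := J) s); last by rewrite cardJ.
apply: eq_bigr => u _; have [->|nz] := eqVneq (transversal (u 0 \o s)) 0.
  by rewrite !mulr0.
have wt : (\sum_x bits (u 0%R) x = m)%N.
  by apply: etrans (transversal_weight nz); apply: (reindex_inj (@perm_inj _ s)).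
have nqp : column q != column p by rewrite eq_sym.
have nrq : column r != column q by rewrite eq_sym.
rewrite (transversal_rot_distinct nqp nrp nrq wt rot1 rot2); congr (_ * _).
by apply: eq_bigl => j; rewrite !inE !negb_or.
Qed.

Lemma rotation_tperm (p q r : 'I_n) : p != q -> q != r -> p != r ->
  rotation (tperm p q * tperm q r)%g p q r /\ rotation (tperm q r * tperm p q)%g r q p.
Proof.
move=> pq qr pr.
have [qp rq rp] : [/\ q != p, r != q & r != p] by rewrite ![_ == p]eq_sym ![r == q]eq_sym.
split; split=> [|||x x1 x2 x3]; rewrite permM.
- by rewrite !tpermL.
- by rewrite tpermR tpermD.
- by rewrite [tperm p q r]tpermD // tpermR.
- by rewrite [tperm p q x]tpermD ?[p == _]eq_sym ?[q == _]eq_sym // tpermD // eq_sym.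
- by rewrite !tpermR.
- by rewrite tpermL tpermD.
- by rewrite [tperm q r p]tpermD // tpermL.
- by rewrite [tperm q r x]tpermD ?[r == _]eq_sym ?[q == _]eq_sym // tpermD // eq_sym.
Qed.

(** This gives the relation 1 + c + c^2 = 0 on the image of the standard polytabloid in the
    quotient. Pairing with a translate of that polytabloid is the sum computed in
    [sum_rotations]. *)
Lemma std_poly_rotation p q r : p != q -> q != r -> p != r ->
  (std_poly *m (1%:M + permr (tperm p q * tperm q r)%g + permr (tperm q r * tperm p q)%g)
    <= Specht_perp_mx 'F_2 n la)%MS.
Proof.
move=> pq qr pr; set v := _ *m _; apply/sub_kermxP.
rewrite -[v]trmxK -trmx_mul (_ : Specht_mx _ _ _ *m v^T = 0) ?trmx0 //.
apply/sub_kermxP/sumsmx_subP => T _; rewrite genmxE; apply/sub_kermxP/matrixP => i j.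
have [s ->] := tableau_std T; rewrite -polytabloid_act !ord1 mxE [RHS]mxE.
have [rot1 rot2] := rotation_tperm pq qr pr.
rewrite -[RHS](sum_rotations s pq qr pr rot1 rot2) -sum_tabloids; last first.
  move=> u; rewrite mulf_eq0 negb_or => /andP[_ nz].
  by apply: etrans (transversal_weight nz); apply: (reindex_inj (@perm_inj _ s)).
rewrite (reindex (@enum_rank _)) /=; last exact/onW_bij/enum_rank_bij.
apply: eq_bigr => t _; rewrite mulrC.
have eb : (\row_x bit t x) 0 =1 bit t by move=> x; rewrite mxE.
have ebc (c : 'S_n) : transversal (bit t \o c) = transversal ((\row_x bit t x) 0 \o c).
  by apply: eq_transversal => x; rewrite /= eb.
congr (_ * _); last by rewrite -ebc; rewrite (std_poly_act s) enum_rankK.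
rewrite mxE /v !mulmxDr mulmx1 [LHS]mxE [X in X + _]mxE !std_poly_act std_polyE enum_rankK.
by rewrite (eq_transversal eb) !ebc.
Qed.

End Tabloids.

(** * The module D^(m+1,m) *)

(** The quotient map as a matrix, so that the section can be studied through row vectors of the
    ambient module. *)
Lemma section_projection (F : fieldType) (gT : finGroupType) (G : {group gT}) k
    (rG : mx_representation F G k) (U V : 'M_k) (modU : mxmodule rG U) (modV : mxmodule rG V) :
  exists p : 'M_(k, \rank <<in_factmod U V>>),
  [/\ forall (v : 'rV_k) g, (v <= V)%MS -> g \in G ->
        v *m rG g *m p = v *m p *m section_repr modU modV g,
      forall w : 'rV_(\rank <<in_factmod U V>>), exists2 v : 'rV_k, (v <= V)%MS & w = v *m p
    & forall v : 'rV_k, (v <= V)%MS -> (v *m p == 0) = (v <= U)%MS].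
Proof.
pose W := <<in_factmod U V>>%MS.
pose p := in_factmod U 1%:M *m in_submod W 1%:M.
have pE (v : 'rV_k) : v *m p = in_submod W (in_factmod U v).
  by rewrite mulmxA -in_factmodE -in_submodE.
have subW (v : 'rV_k) : (v <= V)%MS -> (in_factmod U v <= W)%MS.
  by move=> vV; rewrite genmxE submxMr.
exists p; split=> [v g vV Gg|w|v vV].
- rewrite !pE (in_factmodJ modU) //.
  exact: (in_submodJ (section_module modU modV) _ (subW v vV)).
- have := val_submodP w; rewrite genmxE => /submxP[a ea].
  exists (a *m V); rewrite ?submxMl // pE -[LHS](val_submodK (U := W)).
  by congr (in_submod _ _); rewrite ea /in_factmod /= mulmxA.
rewrite pE -in_factmod_eq0; apply/eqP/eqP => [e|->]; last by rewrite linear0.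
by rewrite -(in_submodK (subW v vV)) e linear0.
Qed.

Section SpinModule.

Variable m : nat.
Local Notation n := (2 * m).+1.
Local Notation la := [:: m.+1; m].
Local Notation permr := (tabloid_repr 'F_2 n la).
Local Notation S := (Specht_mx 'F_2 n la).
Local Notation rD := (spin_module m).

Lemma std_poly_Specht : (std_poly m <= S)%MS.
Proof. by rewrite (sumsmx_sup (std_tableau m)) // genmxE. Qed.

Lemma Specht_act s (v : 'rV_(#|{: tabloid n la}|)) : (v <= S)%MS -> (v *m permr s <= S)%MS.
Proof. by move=> vS; rewrite mxmodule_trans ?Specht_module ?in_setT. Qed.

(** Translates of the standard polytabloid span the Specht module, and invariance of the form shifts
    the translation onto v. *)
Lemma sub_Specht_perp (v : 'rV_(#|{: tabloid n la}|)) :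
  (forall s, v *m permr s *m (std_poly m)^T = 0) -> (v <= Specht_perp_mx 'F_2 n la)%MS.
Proof.
move=> v0; apply/sub_kermxP.
rewrite -[v]trmxK -trmx_mul (_ : S *m v^T = 0) ?trmx0 //.
apply/sub_kermxP/sumsmx_subP => T _; rewrite genmxE; apply/sub_kermxP.
have [s ->] := tableau_std T; rewrite -polytabloid_act -mulmxA -[tabloid_mx _ _ s]trmxK.
rewrite -trmx_mul tr_tabloid_mx -[polytabloid _ _]trmxK -trmx_mul.
by rewrite (v0 s^-1%g) trmx0.
Qed.

Lemma spin_projection : exists p : 'M_(#|{: tabloid n la}|, spin_dim m),
  [/\ forall (v : 'rV_(#|{: tabloid n la}|)) g, (v <= S)%MS ->
        v *m permr g *m p = v *m p *m rD g,
      forall w : 'rV_(spin_dim m), exists2 v : 'rV_(#|{: tabloid n la}|), (v <= S)%MS & w = v *m p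
    & forall v : 'rV_(#|{: tabloid n la}|), (v <= S)%MS ->
        (v *m p == 0) = (v <= Specht_perp_mx 'F_2 n la)%MS].
Proof.
have [p [p1 p2 p3]] := section_projection (Specht_rad_module 'F_2 n la) (Specht_module 'F_2 n la).
exists p; split=> [v g vS|w|v vS]; [by apply: p1; rewrite ?in_setT | exact: p2 |].
by rewrite p3 // sub_capmx vS.
Qed.

Hypothesis d_gt0 : (0 < spin_dim m)%N.

(** The vector e is the image of the standard polytabloid. On the permutation module the pair
    product sends v to (v . e) e, the starting point of the submodule theorem. *)
Lemma spin_generator : exists e : 'rV_(spin_dim m),
  [/\ forall k (W : 'M_(k, spin_dim m)), (forall s, e *m rD s <= W)%MS -> (1%:M <= W)%MS,
      forall w : 'rV_(spin_dim m), (w *m pair_product rD m <= e)%MS,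
      forall w : 'rV_(spin_dim m), (forall s, w *m rD s *m pair_product rD m = 0) -> w = 0
    & forall p q r, p != q -> q != r -> p != r ->
        e *m (1%:M + rD (tperm p q * tperm q r)%g + rD (tperm q r * tperm p q)%g) = 0].
Proof.
have [p [pJ p_onto p_eq0]] := spin_projection.
have gen k (W : 'M_(k, spin_dim m)) :
    (forall s, std_poly m *m p *m rD s <= W)%MS -> (1%:M <= W)%MS.
  move=> eW; apply/rV_subP => w _; have [v vS ->] := p_onto w.
  apply: submx_trans (submxMr p vS) _.
  rewrite /Specht_mx sumsmxMr_gen; apply/sumsmx_subP => T _.
  rewrite genmxE (eqmxMr _ (genmxE _)); have [s ->] := tableau_std T.
  by rewrite -polytabloid_act (pJ _ s (std_poly_Specht)) eW.
have pairs k (v : 'rV_(#|{: tabloid n la}|)) : (v <= S)%MS ->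
    (v *m pair_product permr k <= S)%MS /\
    v *m pair_product permr k *m p = v *m p *m pair_product rD k.
  move=> vS; elim: k => [|k [IHS IHp]]; first by rewrite /= !mulmx1.
  have -> : v *m pair_product permr k.+1 = v *m pair_product permr k
      + v *m pair_product permr k *m permr (tperm (pt m (2 * k)) (pt m (2 * k).+1)).
    by rewrite /= mulmxA mulmxDr mulmx1.
  split; first by apply: addmx_sub => //; apply: Specht_act.
  by rewrite mulmxDl pJ // IHp [pair_product rD k.+1]/=
    (mulmxA _ (pair_product rD k)) mulmxDr mulmx1.
have pairE (v : 'rV_(#|{: tabloid n la}|)) : (v <= S)%MS -> v *m p *m pair_product rD m
    = (v *m (std_poly m)^T) *m (std_poly m *m p).
  by move=> vS; have [_ <-] := pairs m v vS; rewrite pair_product_permr !mulmxA.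
have scal (a : 'M['F_2]_1) : a = (a 0 0)%:M by rewrite -mx11_scalar.
have e_nz : std_poly m *m p != 0.
  apply: contraTneq d_gt0 => e0.
  have : (1%:M <= (0 : 'M['F_2]_(1, spin_dim m)))%MS.
    by apply: gen => s; rewrite e0 mul0mx sub0mx.
  by rewrite -eqn0Ngt => /mxrankS; rewrite mxrank1 mxrank0 leqn0.
exists (std_poly m *m p); split=> // [w|w w0|i j k ij jk ik].
- by have [v vS ->] := p_onto w; rewrite pairE // submxMl.
- have [v vS ev] := p_onto w; apply/eqP; rewrite ev p_eq0 //; apply: sub_Specht_perp => s.
  (* As e has nonzero image, the coefficient (v s . e) must vanish for every s. *)
  have := w0 s; rewrite ev -pJ // pairE ?Specht_act // [_ *m _^T]scal mul_scalar_mx.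
  move/eqP; rewrite scaler_eq0 (negbTE e_nz) orbF => /eqP ->.
  by rewrite raddf0.
have eS := std_poly_Specht.
have := std_poly_rotation ij jk ik.
move: (tperm i j * _)%g (tperm j k * _)%g => c1 c2.
rewrite ![_ *m (_ + _)]mulmxDr !mulmx1 => three.
have e1 := pJ _ c1 eS; have e2 := pJ _ c2 eS.
have s1 := Specht_act c1 eS; have s2 := Specht_act c2 eS.
move: (rD c1) (rD c2) e1 e2 => M1 M2.
move: (std_poly m *m permr c1) (std_poly m *m permr c2) s1 s2 three => v1 v2 s1 s2 three e1 e2.
rewrite -e1 -e2 -!mulmxDl; apply/eqP.
by rewrite p_eq0 // !addmx_sub.
Qed.

End SpinModule.

(** * Relations, irreducibility and centralizer from a cyclic generator *)

Section CyclicGenerator.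

Variables (m d : nat) (rD : mx_representation 'F_2 [set: 'S_(2 * m).+1] d).
Local Notation n := (2 * m).+1.
Variable e : 'rV['F_2]_d.
Hypothesis d_gt0 : (0 < d)%N.
Hypothesis gen : forall k (W : 'M_(k, d)), (forall s, e *m rD s <= W)%MS -> (1%:M <= W)%MS.
Hypothesis pair_e : forall w : 'rV_d, (w *m pair_product rD m <= e)%MS.
Hypothesis nondeg : forall w : 'rV_d,
  (forall s, w *m rD s *m pair_product rD m = 0) -> w = 0.
Hypothesis e3 : forall p q r, p != q -> q != r -> p != r ->
  e *m (1%:M + rD (tperm p q * tperm q r)%g + rD (tperm q r * tperm p q)%g) = 0.

(** The kernel of 1 + c + c^-1 contains each e s: moving s to the right replaces c by a conjugate
    3-cycle, to which [e3] applies. These vectors span. *)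
Lemma tperm_anticomm i j k : i != j -> j != k -> i != k ->
  rD (tperm i j) *m rD (tperm j k) + rD (tperm j k) *m rD (tperm i j) = 1%:M.
Proof.
move=> ij jk ik.
have : (1%:M <= kermx (1%:M + rD (tperm i j * tperm j k)%g + rD (tperm j k * tperm i j)%g))%MS.
  apply: gen => s; apply/sub_kermxP.
  have inj x y : x != y -> (s^-1)%g x != (s^-1)%g y by rewrite (inj_eq perm_inj).
  have := e3 (inj _ _ ij) (inj _ _ jk) (inj _ _ ik).
  move/(congr1 (mulmx^~ (rD s))); rewrite mul0mx -!tpermJ -!conjMg => e0.
  rewrite -[RHS]e0 -!mulmxA; congr (_ *m _).
  rewrite !mulmxDr !mulmxDl mul1mx mulmx1 -!repr_permM.
  by congr (_ + rD _ + rD _); rewrite conjgE invgK !mulgA mulgKV.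
move/sub_kermxP; rewrite mul1mx !repr_permM -addrA => e0.
by rewrite -[LHS](addKr_F2 1%:M) e0 addr0.
Qed.

Lemma pair_product_sub (W : 'M_d) k : mxmodule rD W ->
  (W *m pair_product rD k <= W)%MS.
Proof.
move=> modW; elim: k => [|k IHk]; first by rewrite mulmx1.
rewrite /= mulmxA mulmxDr mulmx1 addmx_sub //.
by apply: submx_trans (submxMr _ IHk) _; apply: (mxmoduleP modW); rewrite in_setT.
Qed.

Lemma rank_pair_product_spin : (\rank (pair_product rD m) <= 1)%N.
Proof.
apply: leq_trans (rank_leq_row e); apply: mxrankS.
by apply/row_subP => i; rewrite rowE pair_e.
Qed.

Lemma F2_line (u v : 'rV['F_2]_d) : (u <= v)%MS -> u != 0 -> u = v.
Proof.
move=> /sub_rVP[a ->]; case: (F2_cases a) => ->; rewrite ?scale1r //.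
by rewrite scale0r eqxx.
Qed.

(** By nondegeneracy the pair product sends some translate of a nonzero v in W to a nonzero multiple
    of e, that is, to e itself; and e generates. *)
Lemma spin_irreducible : mx_irreducible rD.
Proof.
apply/mx_irrP; split=> // W modW /rowV0Pn[v vW nzv]; rewrite -sub1mx.
have [/forallP e0|] := boolP [forall s, v *m rD s *m pair_product rD m == 0].
  by case/eqP: nzv; apply: nondeg => s; apply/eqP.
rewrite negb_forall => /existsP[s nz]; apply: gen => s'.
rewrite -(F2_line (pair_e _) nz).
have act (u : 'rV_d) g : (u <= W)%MS -> (u *m rD g <= W)%MS.
  by move=> uW; apply: submx_trans (submxMr _ uW) _; apply: (mxmoduleP modW); rewrite in_setT.
apply: (act _ s'); apply: submx_trans (pair_product_sub m modW).
by apply: submxMr; apply: act.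
Qed.

(** Write e as the image of some w under the pair product. As A commutes with that product, e A is a
    multiple c e. Then A - c kills e and commutes with the group, hence is 0. *)
Lemma spin_centralizer (A : 'M_d) :
  (forall g, A *m rD g = rD g *m A) -> exists c, A = c%:M.
Proof.
move=> cA; have [w we] : exists w : 'rV_d, w *m pair_product rD m = e.
  have nz1 : delta_mx 0 (Ordinal d_gt0) != 0 :> 'rV['F_2]_d.
    by apply/rV0Pn; exists (Ordinal d_gt0); rewrite mxE !eqxx.
  move: (delta_mx _ _) nz1 => v nzv.
  have [/forallP e0|] := boolP [forall s, v *m rD s *m pair_product rD m == 0].
    by case/eqP: nzv; apply: nondeg => s; apply/eqP.
  by rewrite negb_forall => /existsP[s nz]; exists (v *m rD s); apply: F2_line.
have pairA k : pair_product rD k *m A = A *m pair_product rD k.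
  elim: k => [|k IHk]; first by rewrite mulmx1 mul1mx.
  by rewrite /= -mulmxA mulmxDl mul1mx -cA -{1}(mulmx1 A) -mulmxDr mulmxA IHk mulmxA.
have /sub_rVP[c eA] : (e *m A <= e)%MS by rewrite -{1}we -mulmxA pairA mulmxA pair_e.
exists c; apply/eqP; rewrite -subr_eq0; apply/eqP.
rewrite -[LHS]mul1mx; apply/sub_kermxP; apply: gen => s; apply/sub_kermxP.
by rewrite -mulmxA mulmxBr -cA scalar_mxC -mulmxBl mulmxA mulmxBr eA mul_mx_scalar subrr mul0mx.
Qed.

End CyclicGenerator.

Theorem theorem2 (m : nat) (hm0 : (0 < m)%N) (hm : m = 3 %[mod 4])
  (Q : 'rV['F_2]_(spin_dim m) -> 'F_2)
  (hQ : quadratic_form Q)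
  (hQ_nondeg : nondegenerate_form Q)
  (hQ_inv : invariant_form (spin_module m) Q)
  (x : 'I_(2 * m).+1)
  (U1 U2 : 'M['F_2]_(spin_dim m))
  (hU1 : mxsimple (spin_Alt m) U1)
  (hU2 : mxsimple (spin_Alt m) U2)
  (hU12 : ~ mx_iso (spin_Alt m) U1 U2)
  (hsum : (U1 + U2 :=: 1%:M)%MS)
  (hdirect : mxdirect (U1 + U2)) :
  let U := module_socle (spin_stab x) in
  totally_singular Q U1 /\ totally_singular Q U2 /\
  forall g : 'I_(2 * m).+1 -> 'S_(2 * m).+1,
    g ord0 = 1%g ->
    (forall s : 'S_(2 * m).+1, exists! i, s \in (point_stabilizer x :* g i)%g) ->
    let spread := [set <<U *m spin_module m (g i)>>%MS | i : 'I_(2 * m).+1]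
                  :|: [set <<U1>>%MS; <<U2>>%MS] in
    partial_orthogonal_spread Q (2 ^ m.-1)%N spread /\ #|spread| = (2 * m + 3)%N.
Proof.
have odd_m : odd m by move: hm; lia.
have m_gt1 : (1 < m)%N by move: hm; lia.
have d_gt0 : (0 < spin_dim m)%N.
  case: hU1 => _ nz _; apply: leq_trans (rank_leq_row U1).
  by rewrite lt0n mxrank_eq0.
have [e [gen pair_e nondeg e3]] := @spin_generator m d_gt0.
apply: (@spread_of_spin_relations m (spin_dim m) (spin_module m)
  (tperm_anticomm gen e3) odd_m (rank_pair_product_spin pair_e)
  (spin_irreducible d_gt0 gen pair_e nondeg)
  (spin_centralizer d_gt0 gen pair_e nondeg) hm0 Q hQ hQ_nondeg hQ_inv m_gt1 x
  (subsetT _) (subsetT _) U1 U2 hU1 hU2 hU12 hsum hdirect).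
Qed.
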